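(* Consider the distributed cooperative multi-agent multi-armed bandit problem under the unconstrained reward model with sub-Gaussian rewards, in which all agents use the coop-UCB2 algorithm with parameters $\sigma_g>0$, $\gamma>1$, $\eta\in(0,4)$ and increasing sublogarithmic function $f$. Then for every suboptimal arm $i$ the number of times arm $i$ is selected by all agents until time $T$ satisfies $$\sum_{k=1}^M\mathbb E[n_i^k(T)]\le\frac{4\sigma_g^2\gamma\ln T}{\Delta_i^2G(\eta)}\left(1+\sqrt{1+\frac{\Delta_i^2MG(\eta)}{2\gamma\sigma_g^2}\frac{f(T)}{\ln T}}\right)+L,$$ where $$L=L(\epsilon_n,\epsilon_c^1,\dots,\epsilon_c^M)=\sum_{k=1}^M(t_k^\dagger-1)+M(1+\epsilon_n)+1+\frac{2M}{\ln(1+\eta)}\left(\frac{1}{(\gamma-1)^2}+\frac{\gamma\ln\big((1+\epsilon_n)(1+\eta)\big)}{\gamma-1}+1\right)$$ is a constant independent of $T$, and $t_k^\dagger=f^{-1}(\epsilon_c^k)$.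
   Context: There are $M$ agents and $N$ arms. The agents are the nodes of a connected undirected graph $\mathcal G$ with Laplacian $L_{\mathcal G}\in\mathbb R^{M\times M}$ and maximum degree $d_{\max}$. Set $P=I_M-\frac{\kappa}{d_{\max}}L_{\mathcal G}$ with $\kappa\in(0,1]$. The eigenvalues of $P$ are $\lambda_1=1>\lambda_2\ge\dots\ge\lambda_M>-1$ (standing assumption), with corresponding orthonormal eigenvectors $\mathbf u_1,\dots,\mathbf u_M$, $\mathbf u_1=\mathbf 1_M/\sqrt M$; $u_p^d$ denotes the $d$-th entry of $\mathbf u_p$. At each time $t=1,\dots,T$ agent $k$ selects one arm $i^k(t)$; $\xi_i^k(t)=1$ if $i^k(t)=i$ and $0$ otherwise; $n_i^k(T)$ is the number of times agent $k$ selects arm $i$ until time $T$. $r_i^k(t)$ is the realized reward at arm $i$ for agent $k$ at time $t$. For each $i$ and $k$, $\{r_i^k(t)\}_t$ is i.i.d. sub-Gaussian with mean $m_i$; rewards of different agents are independent and identically distributed for a given arm, and rewards at time $t$ are independent of all measurements before time $t$. A real random variable $X$ with mean $m$ is sub-Gaussian (with parameter $\sigma_g>0$) if $\ln\mathbb E[\exp(\beta X)]\le m\beta+\frac{\sigma_g^2\beta^2}{2}$ for all $\beta\in\mathbb R$. Unconstrained reward model: agent $k$ receives $r_{i^k(t)}^k(t)$ at time $t$ irrespective of the choices of other agents. The arm with highest mean is $i^*$; arm $i$ is suboptimal if $i\ne i^*$; $\Delta_i=m_{i^*}-m_i$. Arm means are distinct. Cooperative estimation: $\hat{\mathbf n}_i(t)=P(\hat{\mathbf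 n}_i(t-1)+\boldsymbol\xi_i(t))$, $\hat{\mathbf s}_i(t)=P(\hat{\mathbf s}_i(t-1)+\mathbf r_i(t))$, $\hat{\mathbf n}_i(0)=\hat{\mathbf s}_i(0)=0$, $\hat\mu_i^k(t)=\hat s_i^k(t)/\hat n_i^k(t)$, where $\hat{\mathbf n}_i,\hat{\mathbf s}_i,\boldsymbol\xi_i,\mathbf r_i$ are the vectors over $k\in\{1,\dots,M\}$ with entries $\hat n_i^k,\hat s_i^k,\xi_i^k,r_i^k\xi_i^k$. coop-UCB2 algorithm: for $t\le N$ every agent selects arm $t$ (each agent samples each arm once). For $t>N$, each agent $k$ selects an arm maximizing $Q_i^k(t-1)=\hat\mu_i^k(t-1)+C_i^k(t-1)$ over $i\in\{1,\dots,N\}$, where $$C_i^k(t-1)=\sigma_g\sqrt{\frac{2\gamma}{G(\eta)}\cdot\frac{\hat n_i^k(t-1)+f(t-1)}{M\hat n_i^k(t-1)}\cdot\frac{\ln(t-1)}{\hat n_i^k(t-1)}},\qquad G(\eta)=1-\frac{\eta^2}{16}.$$ The estimates are updated at each time with the cooperative estimation algorithm. Here $f$ is increasing and sublogarithmic ($f(t)/\ln t\to0$), and $f^{-1}$ is its inverse (the notation presupposes that each $\epsilon_c^k$ lies in the range of $f$). The graph explore-exploit index is $$\epsilon_n=\sqrt M\sum_{p=2}^M\frac{|\lambda_p|}{1-|\lambda_p|}.$$ The nodal explore-exploit centrality index of node $k$ is $$\epsilon_c^k=M\sum_{p=1}^M\sum_{j=2}^M\frac{|\lambda_p\lambda_j|}{1-|\lambda_p\lambda_j|}a_{pj}(k),$$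 where $a_{pj}(k)=\nu_{pj}^{\text{+sum}}u_p^ku_j^k$ if $\lambda_p\lambda_j\ge0$ and $u_p^ku_j^k\ge0$; $a_{pj}(k)=\nu_{pj}^{\text{-sum}}u_p^ku_j^k$ if $\lambda_p\lambda_j\ge0$ and $u_p^ku_j^k\le0$; $a_{pj}(k)=\nu_{pj}^{\max}|u_p^ku_j^k|$ if $\lambda_p\lambda_j<0$; with $\nu_{pj}^{\text{+sum}}=\sum_{d=1}^Mu_p^du_j^d\,\mathds 1(u_p^du_j^d\ge0)$, $\nu_{pj}^{\text{-sum}}=\sum_{d=1}^Mu_p^du_j^d\,\mathds 1(u_p^du_j^d\le0)$, $\nu_{pj}^{\max}=\max\{|\nu_{pj}^{\text{-sum}}|,\nu_{pj}^{\text{+sum}}\}$, where $\mathds 1(\cdot)$ is the indicator function. *)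

(* Defs.v *)
From mathcomp Require Import all_boot all_order all_algebra.
From mathcomp Require Import all_classical all_reals all_analysis.

Set Implicit Arguments.
Unset Strict Implicit.
Unset Printing Implicit Defensive.

Import Order.TTheory GRing.Theory Num.Theory.
Import numFieldNormedType.Exports.

Local Open Scope classical_set_scope.
Local Open Scope ring_scope.

(* Agents are the elements of 'I_M and arms those of 'I_N: the j-th arm is the
   ordinal of value j - 1, and likewise for agents and for the eigenpairs of the
   consensus matrix; "p = 1" thus reads p = 0 and "p >= 2" reads 0 < p.  Time is a natural number; rounds are t = 1, 2, ..., and values
   of time-indexed families at 0 are never constrained. *)

(** ** Communication graph and consensus matrix *)

Definition connected_graph (M : nat) (e : rel 'I_M) : Prop :=
  [/\ symmetric e, irreflexive e & forall j k, connect e j k].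

Definition degree (M : nat) (e : rel 'I_M) (k : 'I_M) : nat :=
  #|[set j | e k j]%SET|.

Definition max_degree (M : nat) (e : rel 'I_M) : nat := \max_(k < M) degree e k.

Definition laplacian (R : realType) (M : nat) (e : rel 'I_M) : 'M[R]_M :=
  \matrix_(j, k) (if j == k then (degree e j)%:R else - (e j k)%:R).

(* For M = 1 the maximum degree is 0, and k / 0 = 0 makes this matrix 1%:M. *)
Definition consensus_mx (R : realType) (M : nat) (e : rel 'I_M) (kappa : R) :
    'M[R]_M :=
  1%:M - (kappa / (max_degree e)%:R) *: laplacian R e.

Record spectrum_of (R : realType) (M : nat) (Pm : 'M[R]_M)
    (lambda : 'I_M -> R) (u : 'I_M -> 'cV[R]_M) : Prop := SpectrumOf {
  spec_eigen : forall p, Pm *m u p = lambda p *: u p;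
  spec_orthonormal : forall p q, \sum_(d < M) u p d 0 * u q d 0 = (p == q)%:R;
  spec_u1 : forall p : 'I_M, p = 0%N :> nat -> u p = const_mx (Num.sqrt M%:R)^-1;
  spec_lambda1 : forall p : 'I_M, p = 0%N :> nat -> lambda p = 1;
  spec_lt1 : forall p : 'I_M, (0 < p)%N -> lambda p < 1;
  spec_sorted : forall p q : 'I_M, (p <= q)%N -> lambda q <= lambda p;
  spec_gtN1 : forall p : 'I_M, -1 < lambda p }.

Definition eps_n (R : realType) (M : nat) (lambda : 'I_M -> R) : R :=
  Num.sqrt M%:R *
  \sum_(p < M | (0 < p)%N) `|lambda p| / (1 - `|lambda p|).

Section Centrality.
Context (R : realType) (M : nat) (lambda : 'I_M -> R) (u : 'I_M -> 'cV[R]_M).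

Definition nu_plus (p j : 'I_M) : R :=
  \sum_(d < M | 0 <= u p d 0 * u j d 0) u p d 0 * u j d 0.

Definition nu_minus (p j : 'I_M) : R :=
  \sum_(d < M | u p d 0 * u j d 0 <= 0) u p d 0 * u j d 0.

Definition nu_max (p j : 'I_M) : R :=
  Num.max `|nu_minus p j| (nu_plus p j).

Definition a_coef (p j k : 'I_M) : R :=
  if 0 <= lambda p * lambda j then
    if 0 <= u p k 0 * u j k 0 then nu_plus p j * (u p k 0 * u j k 0)
    else nu_minus p j * (u p k 0 * u j k 0)
  else nu_max p j * `|u p k 0 * u j k 0|.

Definition eps_c (k : 'I_M) : R :=
  M%:R * \sum_(p < M) \sum_(j < M | (0 < j)%N)
    `|lambda p * lambda j| / (1 - `|lambda p * lambda j|) * a_coef p j k.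

End Centrality.

(** ** Rewards *)

Definition sub_gaussian d (Omega : measurableType d) (R : realType)
    (P : probability Omega R) (sigma m : R) (X : {RV P >-> R}) : Prop :=
  ('E_P[X] = m%:E)%E /\
  forall beta : R,
    (lne (mmt_gen_fun P X beta) <= (m * beta + sigma ^+ 2 * beta ^+ 2 / 2)%:E)%E.

Definition mutually_independent d (Omega : measurableType d) (R : realType)
    (P : probability Omega R) (I : eqType) (D : set I)
    (X : I -> {RV P >-> R}) : Prop :=
  forall (s : seq I) (B : I -> set R), uniq s ->
    (forall x, x \in s -> D x) ->
    (forall x, x \in s -> measurable (B x)) ->
    P (\bigcap_(x in [set` s]) (X x @^-1` B x)) =
    (\prod_(x <- s) P (X x @^-1` B x))%E.

Definition independent_systems d (Omega : measurableType d) (R : realType)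
    (P : probability Omega R) (F G : set_system Omega) : Prop :=
  forall A B, F A -> G B -> P (A `&` B) = (P A * P B)%E.

Section RewardModel.
Context d (Omega : measurableType d) (R : realType) (P : probability Omega R).
Context (M N : nat).
(* r i k t is the reward at arm i for agent k at time t, and act k t w the arm
   selected by agent k at time t. *)
Context (r : 'I_N -> 'I_M -> nat -> {RV P >-> R}).
Context (act : 'I_M -> nat -> Omega -> 'I_N).

(* Unconstrained reward model: an agent receives its own reward at the arm it
   selects, whatever the other agents do. *)
Definition received (k : 'I_M) (t : nat) (w : Omega) : R := r (act k t w) k t w.

(* The information available when round t is played: the measurements received
   and the selections made in earlier rounds, and the selections of round t,
   which are made before its rewards are revealed. *)
Definition history (t : nat) : set_system Omega :=
  <<s (\bigcup_(s in [set s | (0 < s < t)%N]) \bigcup_k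
         preimage_set_system setT (received k s) measurable)
      `|`
      (\bigcup_(s in [set s | (0 < s <= t)%N]) \bigcup_k
         preimage_set_system setT (act k s) setT) >>.

Definition rewards_at (t : nat) : set_system Omega :=
  <<s \bigcup_i \bigcup_k preimage_set_system setT (r i k t) measurable >>.

Record reward_model (m : 'I_N -> R) (sigma : R) : Prop := RewardModel {
  rm_sub_gaussian : forall i k t, (0 < t)%N -> sub_gaussian sigma (m i) (r i k t);
  rm_ident : forall i k k' t t', (0 < t)%N -> (0 < t')%N ->
    forall B, measurable B ->
      distribution P (r i k t) B = distribution P (r i k' t') B;
  rm_indep : forall i,
    mutually_independent [set kt : 'I_M * nat | (0 < kt.2)%N]
      (fun kt => r i kt.1 kt.2);
  rm_past : forall t, (0 < t)%N ->
    independent_systems P (rewards_at t) (history t) }.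

End RewardModel.

(** ** Cooperative estimation and the coop-UCB2 algorithm *)

Fixpoint coop_est (R : realType) (M : nat) (Pm : 'M[R]_M)
    (x : nat -> 'cV[R]_M) (t : nat) : 'cV[R]_M :=
  if t is s.+1 then Pm *m (coop_est Pm x s + x t) else 0.

Definition G (R : realType) (eta : R) : R := 1 - eta ^+ 2 / 16.

Section CoopUCB2.
Context d (Omega : measurableType d) (R : realType) (P : probability Omega R).
Context (M N : nat) (Pm : 'M[R]_M).
Context (r : 'I_N -> 'I_M -> nat -> {RV P >-> R}).
Context (act : 'I_M -> nat -> Omega -> 'I_N).
Context (sigma gamma eta : R) (f : R -> R).

Definition xi (i : 'I_N) (t : nat) (w : Omega) : 'cV[R]_M :=
  \col_k (act k t w == i)%:R.

Definition rvec (i : 'I_N) (t : nat) (w : Omega) : 'cV[R]_M :=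
  \col_k (r i k t w * (act k t w == i)%:R).

Definition nhat (i : 'I_N) (k : 'I_M) (t : nat) (w : Omega) : R :=
  coop_est Pm (fun s => xi i s w) t k 0.

Definition shat (i : 'I_N) (k : 'I_M) (t : nat) (w : Omega) : R :=
  coop_est Pm (fun s => rvec i s w) t k 0.

Definition muhat (i : 'I_N) (k : 'I_M) (t : nat) (w : Omega) : R :=
  shat i k t w / nhat i k t w.

Definition bonus (i : 'I_N) (k : 'I_M) (t : nat) (w : Omega) : R :=
  sigma * Num.sqrt (2 * gamma / G eta *
                    ((nhat i k t w + f t%:R) / (M%:R * nhat i k t w)) *
                    (ln t%:R / nhat i k t w)).

Definition Qidx (i : 'I_N) (k : 'I_M) (t : nat) (w : Omega) : R :=
  muhat i k t w + bonus i k t w.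

(* Ties in the maximization may be broken arbitrarily. *)
Definition coop_UCB2 : Prop :=
  (forall k t i, (0 < t)%N -> measurable (act k t @^-1` [set i])) /\
  (forall k t w, (0 < t)%N ->
     if (t <= N)%N then (act k t w).+1 = t
     else forall j, Qidx j k t.-1 w <= Qidx (act k t w) k t.-1 w).

End CoopUCB2.

Definition nsel (Omega : Type) (M N : nat) (act : 'I_M -> nat -> Omega -> 'I_N)
    (i : 'I_N) (k : 'I_M) (T : nat) (w : Omega) : nat :=
  (\sum_(1 <= t < T.+1) (act k t w == i))%N.

(** ** The bound *)

(* f is a function of time on a half line [t0, +oo[ containing all rounds; its
   values outside of it are irrelevant. *)
Definition increasing_sublog (R : realType) (t0 : R) (f : R -> R) : Prop :=
  (forall x y, t0 <= x -> x < y -> f x < f y) /\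
  (f t / ln t @[t --> +oo] --> (0 : R)).

Definition main_term (R : realType) (M : nat) (sigma gamma eta : R)
    (f : R -> R) (Delta : R) (T : nat) : R :=
  4 * sigma ^+ 2 * gamma * ln T%:R / (Delta ^+ 2 * G eta) *
  (1 + Num.sqrt (1 + Delta ^+ 2 * M%:R * G eta / (2 * gamma * sigma ^+ 2) *
                     (f T%:R / ln T%:R))).

Definition Lconst (R : realType) (M : nat) (gamma eta : R) (finv : R -> R)
    (epsn : R) (epsc : 'I_M -> R) : R :=
  \sum_(k < M) (finv (epsc k) - 1) + M%:R * (1 + epsn) + 1 +
  2 * M%:R / ln (1 + eta) *
  (1 / (gamma - 1) ^+ 2 +
   gamma * ln ((1 + epsn) * (1 + eta)) / (gamma - 1) + 1).

(* Main.v *)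
Require Import Defs.
From mathcomp Require Import all_boot all_order all_algebra.
From mathcomp Require Import all_classical all_reals all_analysis.
From mathcomp Require Import measurable_realfun ring lra zify.

Set Implicit Arguments.
Unset Strict Implicit.
Unset Printing Implicit Defensive.

Import Order.TTheory GRing.Theory Num.Theory.
Import numFieldNormedType.Exports.

Local Open Scope classical_set_scope.
Local Open Scope ring_scope.

(** Why the bound holds.  Unfolding the recursion, the estimates of agent [k]
    are weighted sums over past rounds, the selection of agent [q] in round [s]
    entering at time [t] with the weight [(Pm ^+ (t.+1 - s)) k q].  The matrix
    [Pm] is stochastic, and expanding its powers in the eigenbasis gives two
    facts: [nhat] differs from the average number of selections per agent by at
    most [eps_n] ([consensus_count_deviation]), and [M] times the sum of the
    squared weights of the selections made is at most [nhat + eps_c]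
    ([consensus_variance_le]).  The
    squared weights govern the fluctuations of [shat - m nhat], and the bonus,
    which has [f s] in place of [eps_c], accounts for them as soon as
    [f s >= eps_c], that is from time [finv (eps_c k)] on.

    Fix an agent [k] and a time [s] beyond the initial phase and this
    threshold, and suppose that [k] selects the suboptimal arm [i] in round
    [s.+1].  Comparing the two indices, either the estimate of one of the arms
    [i] and [istar] is off by its bonus, or the gap is less than twice the bonus
    of [i].  The last case is a quadratic inequality in [nhat], which
    bounds the total number of selections by [main_term + M * eps_n]
    ([confidence_width_quadratic]).

    The deviations are handled without events, through pointwise domination.
    For a fixed tilt [beta], the exponential of
    [beta (shat - m nhat) - (sigma beta)^2 V / 2], where [V] is that sum
    of squared weights, has expectation at most 1: built up
    round by round it is a supermartingale, because the rewards of a round are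
    independent of the selections and of the past
    ([integral_log_supermartingale_le1]).  The value of [nhat + f s] is random
    but lies in the range from [1 + f s] to [s (1 + f s)], which is cut into
    about [ln s / ln (1 + eta)] layers of ratio [1 + eta].  Tilting with the
    optimal [beta] of the layer costs only the factor [G eta] in the exponent,
    so on a deviation one of these exponentials is at least
    [expR (gamma * ln s)] ([peeling]).  Hence [tail_bound], the sum of all of
    them divided by that value, is at least 1 on a deviation, while its
    expectation is at most [2 * layers / s ^ gamma].

    An induction on time ([selections_le]) then bounds the number of selections
    by [main_term + M * eps_n + M], plus the rounds before the thresholds, plus
    the sum of the [tail_bound]s.  It remains to take expectations and to sum
    [ln s / s ^ gamma] and [1 / s ^ gamma] over [s >= 2]; the sums start at 2
    since there are at least two arms, and what this saves over sums starting
    at 1 pays for the rounding of the thresholds. *)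

(** * Spectral bounds for the consensus weights *)

Section CooperativeEstimate.
Context (R : realType) (M : nat).
Implicit Types (Pm : 'M[R]_M) (k q : 'I_M).

Lemma sum_geometric_le (x : R) t : 0 <= x < 1 ->
  \sum_(1 <= s < t.+1) x ^+ (t.+1 - s) <= x / (1 - x).
Proof.
move=> /andP[x0 x1]; have x1' : 0 < 1 - x by rewrite subr_gt0.
elim: t => [|t IH]; first by rewrite big_geq// divr_ge0// ltW.
rewrite big_nat_recr//= subSnn expr1.
rewrite (eq_big_nat _ _ (F2 := fun s => x * x ^+ (t.+1 - s))); last first.
  by move=> s /andP[s1 st]; rewrite (subSn (ltnW st)) exprS.
rewrite -mulr_sumr; apply: le_trans (lerD (ler_wpM2l x0 IH) (lexx _)) _.
by rewrite [leLHS](_ : _ = x / (1 - x))//; field; lra.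
Qed.

Lemma coop_estE Pm (x : nat -> 'cV[R]_M) t k : coop_est Pm x t k 0 =
  \sum_(1 <= s < t.+1) \sum_q (Pm ^+ (t.+1 - s)) k q * x s q 0.
Proof.
suff -> : coop_est Pm x t = \sum_(1 <= s < t.+1) (Pm ^+ (t.+1 - s) *m x s).
  by rewrite summxE; apply: eq_bigr => s _; rewrite mxE.
elim: t => [|t IH]; first by rewrite big_geq.
rewrite /= IH [RHS]big_nat_recr//= subSnn expr1 mulmxDr mulmx_sumr; congr (_ + _).
apply: eq_big_nat => s /andP[s1 st].
by rewrite mulmxA (subSn (ltnW st)) exprS.
Qed.

Lemma expmx_ge0 Pm n k q : (forall k q, 0 <= Pm k q) -> 0 <= (Pm ^+ n) k q.
Proof.
move=> P0; elim: n k q => [|n IH] k q; first by rewrite expr0 mxE ler0n.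
by rewrite exprS mxE sumr_ge0// => l _; rewrite mulr_ge0.
Qed.

(** The diagonal entries are [1 - kappa * degree / max_degree]; when there is no
    edge the division by zero makes the matrix the identity. *)
Lemma consensus_mx_ge0 (e : rel 'I_M) (kappa : R) : irreflexive e ->
  0 < kappa <= 1 -> forall k q, 0 <= consensus_mx e kappa k q.
Proof.
move=> irr /andP[k0 k1] k q; rewrite /consensus_mx !mxE.
have D0 : 0 <= kappa / (max_degree e)%:R by rewrite divr_ge0// ltW.
case: eqVneq => [->|kq] /=; last first.
  by rewrite sub0r mulrN opprK mulr_ge0// ler0n.
rewrite subr_ge0.
have degle : (degree e q <= max_degree e)%N by exact: leq_bigmax.
have [D|D] := posnP (max_degree e).
  by rewrite D invr0 mulr0 mul0r.
rewrite mulrAC ler_pdivrMr ?ltr0n// mul1r.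
by apply: le_trans (ler_wpM2r (ler0n _ _) k1) _; rewrite mul1r ler_nat.
Qed.

Section Spectral.
Context (Pm : 'M[R]_M) (lambda : 'I_M -> R) (u : 'I_M -> 'cV[R]_M).
Context (hM : (0 < M)%N).
Context (spec : spectrum_of Pm lambda u).

Let p0 := Ordinal hM.
Let M0 : 0 < M%:R :> R. Proof. by rewrite ltr0n. Qed.

(** The rows of a square matrix with orthonormal columns are orthonormal. *)
Lemma sum_eigenvectors k q : \sum_p u p k 0 * u p q 0 = (k == q)%:R.
Proof.
pose U : 'M[R]_M := \matrix_(i, p) u p i 0.
have UTU : U^T *m U = 1%:M.
  apply/matrixP => p l; rewrite !mxE -(spec_orthonormal spec).
  by apply: eq_bigr => i _; rewrite !mxE.
have /matrixP/(_ k q) := mulmx1C UTU; rewrite !mxE => <-.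
by apply: eq_bigr => p _; rewrite !mxE.
Qed.

Lemma expmx_eigen n p : Pm ^+ n *m u p = lambda p ^+ n *: u p.
Proof.
elim: n => [|n IH]; first by rewrite !expr0 mul1mx scale1r.
rewrite exprSr -mulmxA (spec_eigen spec) -scalemxAr IH scalerA.
by rewrite -exprS.
Qed.

Lemma expmx_spectral n k q :
  (Pm ^+ n) k q = \sum_p lambda p ^+ n * (u p k 0 * u p q 0).
Proof.
transitivity (\sum_l (Pm ^+ n) k l * (l == q)%:R).
  rewrite (bigD1 q)//= eqxx mulr1 big1 ?addr0// => l /negPf->.
  by rewrite mulr0.
under eq_bigr do rewrite -sum_eigenvectors mulr_sumr.
rewrite exchange_big; apply: eq_bigr => p _.
rewrite mulrA.
have := congr1 (fun A : 'cV[R]_M => A k 0) (expmx_eigen n p).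
rewrite !mxE => <-; rewrite mulr_suml.
by apply: eq_bigr => l _; rewrite mulrA.
Qed.

Lemma expmx_row_sum n k : \sum_q (Pm ^+ n) k q = 1.
Proof.
have := congr1 (fun A : 'cV[R]_M => A k 0) (expmx_eigen n p0).
rewrite (spec_lambda1 spec)// expr1n scale1r !mxE (spec_u1 spec)// mxE.
under eq_bigr do rewrite mxE.
rewrite -mulr_suml => /(congr1 (fun x => x * Num.sqrt M%:R)).
by rewrite -mulrA mulVf ?mulr1// gt_eqF// sqrtr_gt0.
Qed.

Lemma eigenvector1 k q : u p0 k 0 * u p0 q 0 = M%:R^-1.
Proof. by rewrite (spec_u1 spec)// !mxE -invfM -expr2 sqr_sqrtr// ltW. Qed.

Lemma normr_eigenvalue_lt1 (p : 'I_M) : (0 < p)%N -> `|lambda p| < 1.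
Proof.
by move=> p1; rewrite ltr_norml (spec_gtN1 spec) (spec_lt1 spec).
Qed.

Lemma normr_eigenvalue_le1 (p : 'I_M) : `|lambda p| <= 1.
Proof.
have [p1|] := posnP p; last by move/normr_eigenvalue_lt1/ltW.
by rewrite (spec_lambda1 spec)// normr1.
Qed.

Lemma normr_eigenvector_le1 p k : `|u p k 0| <= 1.
Proof.
rewrite -(@ler_pXn2r _ 2) ?nnegrE// expr1n real_normK ?num_real//.
rewrite -[leRHS](_ : \sum_q u p q 0 * u p q 0 = 1); last first.
  by rewrite (spec_orthonormal spec) eqxx.
rewrite (bigD1 k)//= -expr2 lerDl sumr_ge0// => q _.
by rewrite -expr2 sqr_ge0.
Qed.

(** Cauchy-Schwarz for a unit vector and a vector with entries in [0, 1]. *)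
Lemma normr_eigenvector_sum p (x : 'I_M -> R) : (forall q, 0 <= x q <= 1) ->
  `|\sum_q u p q 0 * x q| <= Num.sqrt M%:R.
Proof.
move=> x01.
set c : R := Num.sqrt M%:R.
have c0 : 0 < c by rewrite sqrtr_gt0.
have c2 : c ^+ 2 = M%:R by rewrite sqr_sqrtr// ltW.
apply: le_trans (ler_norm_sum _ _ _) _.
apply: (@le_trans _ _ (\sum_q (c * (u p q 0 * u p q 0) + c^-1) / 2)).
  apply: ler_sum => q _; rewrite ler_pdivlMr// normrM.
  have /andP[x0 x1] := x01 q; rewrite (ger0_norm x0).
  have -> : u p q 0 * u p q 0 = `|u p q 0| ^+ 2 by rewrite real_normK ?num_real// expr2.
  set z := `|_|; have z0 : 0 <= z by exact: normr_ge0.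
  (* [z <= (c z^2 + 1 / c) / 2], to be summed with [c = sqrt M] *)
  have : 0 <= c^-1 * (c * z - 1) ^+ 2 by rewrite mulr_ge0 ?sqr_ge0// invr_ge0 ltW.
  have -> : c^-1 * (c * z - 1) ^+ 2 = c * z ^+ 2 + c^-1 - z * 2 by field; rewrite gt_eqF.
  nra.
have cinv : \sum_(q < M) c^-1 = c.
  by rewrite sumr_const card_ord -[c^-1 *+ M]mulr_natl -c2 expr2 mulfK ?gt_eqF.
rewrite -mulr_suml big_split/= -mulr_sumr (spec_orthonormal spec) eqxx mulr1.
by rewrite cinv; lra.
Qed.

Context (x : nat -> 'I_M -> R).
Context (x01 : forall s q, 0 <= x s q <= 1).

(** The eigenvalue 1 contributes the average; every other eigenvalue
    contributes a geometric sum times an inner product of norm at most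
    [sqrt M]. *)
Lemma consensus_count_deviation t k :
  `|\sum_(1 <= s < t.+1) \sum_q (Pm ^+ (t.+1 - s)) k q * x s q -
    (\sum_(1 <= s < t.+1) \sum_q x s q) / M%:R| <= eps_n lambda.
Proof.
have E n s : \sum_q (Pm ^+ n) k q * x s q = (\sum_q x s q) / M%:R +
    \sum_(p < M | (0 < p)%N) lambda p ^+ n * (u p k 0 * \sum_q u p q 0 * x s q).
  under eq_bigr do rewrite expmx_spectral mulr_suml.
  rewrite exchange_big (bigD1 p0)//=; congr (_ + _).
    under eq_bigr do rewrite (spec_lambda1 spec)// expr1n mul1r eigenvector1 mulrC.
    by rewrite mulr_suml.
  apply: eq_big => [p|p _]; first by rewrite -val_eqE/= lt0n.
  by rewrite mulr_sumr mulr_sumr; apply: eq_bigr => q _; ring.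
under eq_bigr do rewrite E.
rewrite big_split/= -mulr_suml addrAC subrr add0r exchange_big/=.
apply: le_trans (ler_norm_sum _ _ _) _.
rewrite /eps_n mulr_sumr; apply: ler_sum => p p1.
apply: le_trans (ler_norm_sum _ _ _) _.
apply: (@le_trans _ _ (\sum_(1 <= s < t.+1) Num.sqrt M%:R * `|lambda p| ^+ (t.+1 - s))).
  apply: ler_sum => s _; rewrite normrM normrX mulrC ler_wpM2r ?exprn_ge0//.
  rewrite normrM -[leRHS]mul1r ler_pM//; first exact: normr_eigenvector_le1.
  exact: normr_eigenvector_sum.
rewrite -mulr_sumr ler_wpM2l ?sqrtr_ge0// sum_geometric_le//.
by rewrite normr_ge0/= normr_eigenvalue_lt1.
Qed.

Lemma nu_plus_ge0 p j : 0 <= nu_plus u p j.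
Proof. by rewrite sumr_ge0. Qed.

Lemma nu_minus_le0 p j : nu_minus u p j <= 0.
Proof. by rewrite sumr_le0. Qed.

Lemma a_coef_ge0 p j k : 0 <= a_coef lambda u p j k.
Proof.
have np := nu_plus_ge0 p j; have nm := nu_minus_le0 p j.
rewrite /a_coef; case: ifP => _; last first.
  by rewrite mulr_ge0// /nu_max le_max normr_ge0.
case: ifPn => [h|]; first by rewrite mulr_ge0.
by rewrite -ltNge => /ltW h; rewrite mulr_le0.
Qed.

Lemma eps_c_ge0 k : 0 <= eps_c lambda u k.
Proof.
rewrite mulr_ge0// sumr_ge0// => p _; rewrite sumr_ge0// => j j1.
rewrite mulr_ge0 ?a_coef_ge0// divr_ge0// subr_ge0 normrM.
rewrite -[leRHS]mul1r ler_pM//; first exact: normr_eigenvalue_le1.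
exact/ltW/normr_eigenvalue_lt1.
Qed.

Lemma eigenvector_products_sum p j s :
  nu_minus u p j <= \sum_q u p q 0 * u j q 0 * x s q <= nu_plus u p j.
Proof.
apply/andP; split; [rewrite /nu_minus big_mkcond/=|rewrite /nu_plus [leRHS]big_mkcond/=];
  apply: ler_sum => q _; have /andP[xl xu] := x01 s q;
  case: ifPn; rewrite -?ltNge; nra.
Qed.

(** The three cases of [a_coef] are the largest value of
    [u p k * u j k * S], up to the sign of [lambda p * lambda j], when [S]
    ranges over the interval from [nu_minus] to [nu_plus]. *)
Lemma eigenpair_term_le p j k n s :
  (lambda p * lambda j) ^+ n * (u p k 0 * u j k 0 * \sum_q u p q 0 * u j q 0 * x s q)
  <= `|lambda p * lambda j| ^+ n * a_coef lambda u p j k.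
Proof.
have /andP[] := eigenvector_products_sum p j s.
set S := \sum_q _ => lo up.
have np := nu_plus_ge0 p j; have nm := nu_minus_le0 p j.
rewrite /a_coef; case: ifPn => [ll|_].
  rewrite (ger0_norm ll) ler_wpM2l ?exprn_ge0//.
  by case: ifPn; rewrite -?ltNge; nra.
apply: le_trans (ler_norm _) _; rewrite normrM normrX ler_wpM2l ?exprn_ge0//.
rewrite normrM mulrC ler_wpM2r// /nu_max le_max (ler0_norm nm).
by have [S0|S0] := leP 0 S; [rewrite ger0_norm|rewrite ltr0_norm]; lra.
Qed.

(** Squaring the spectral expansion of a weight gives a double sum over
    eigenpairs.  The pairs whose second eigenvalue is 1 recombine into
    [weight / M], which yields the estimated count; for each other pair the sum
    over the rounds is geometric. *)
Lemma consensus_variance_le t k :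
  M%:R * (\sum_(1 <= s < t.+1) \sum_q (Pm ^+ (t.+1 - s)) k q ^+ 2 * x s q) <=
  \sum_(1 <= s < t.+1) \sum_q (Pm ^+ (t.+1 - s)) k q * x s q + eps_c lambda u k.
Proof.
have E n s : \sum_q (Pm ^+ n) k q ^+ 2 * x s q =
    (\sum_q (Pm ^+ n) k q * x s q) / M%:R +
    \sum_p \sum_(j < M | (0 < j)%N) (lambda p * lambda j) ^+ n *
      (u p k 0 * u j k 0 * \sum_q u p q 0 * u j q 0 * x s q).
  have sq q : (Pm ^+ n) k q ^+ 2 * x s q = (Pm ^+ n) k q * x s q / M%:R +
      \sum_p \sum_(j < M | (0 < j)%N) (lambda p * lambda j) ^+ n *
        (u p k 0 * u j k 0) * (u p q 0 * u j q 0 * x s q).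
    rewrite expr2 {2}expmx_spectral (bigD1 p0)//= (spec_lambda1 spec)// expr1n.
    rewrite eigenvector1 mul1r mulrDr mulrDl mulrAC; congr (_ + _).
    rewrite expmx_spectral mulrAC mulr_suml mulr_suml; apply: eq_bigr => p _.
    rewrite mulr_sumr; apply: eq_big => [j|j _]; first by rewrite -val_eqE/= lt0n.
    by rewrite exprMn; ring.
  under eq_bigr do rewrite sq.
  rewrite big_split/= -mulr_suml; congr (_ + _).
  rewrite exchange_big; apply: eq_bigr => p _.
  rewrite exchange_big; apply: eq_bigr => j _.
  by rewrite !mulr_sumr; apply: eq_bigr => q _; ring.
under eq_bigr do rewrite E.
rewrite big_split/= mulrDr -mulr_suml mulrCA mulfV ?gt_eqF// mulr1 lerD2l.
rewrite /eps_c ler_wpM2l// exchange_big/=; apply: ler_sum => p _.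
rewrite exchange_big/=; apply: ler_sum => j j1.
apply: (@le_trans _ _ (\sum_(1 <= s < t.+1)
   `|lambda p * lambda j| ^+ (t.+1 - s) * a_coef lambda u p j k)).
  by apply: ler_sum => s _; exact: eigenpair_term_le.
rewrite -mulr_suml ler_wpM2r ?a_coef_ge0// sum_geometric_le//.
rewrite normr_ge0/= normrM; have := normr_eigenvalue_lt1 j1.
by have := normr_eigenvalue_le1 p; have := normr_ge0 (lambda j);
  have := normr_ge0 (lambda p); nra.
Qed.

End Spectral.
End CooperativeEstimate.

(** * Expectations of products of independent factors *)

Section Factorization.
Context d (T : measurableType d) (R : realType) (P : probability T R).
Import HBNNSimple.

(** Expanding a simple function into indicators, the hypothesis on events gives
    the product formula by linearity. *)
Lemma integral_mul_nnsfun (H h : T -> R) (c : R) (phi : {nnsfun R >-> R}) :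
  measurable_fun setT H -> measurable_fun setT h ->
  (forall w, 0 <= H w) -> 0 <= c ->
  (forall B, measurable B ->
    (\int[P]_w (H w * \1_(h @^-1` B) w)%:E = c%:E * P (h @^-1` B))%E) ->
  (\int[P]_w (H w * phi (h w))%:E = \int[P]_w (c * phi (h w))%:E)%E.
Proof.
move=> mH mh H0 c0 hB.
have mI (x : R) : measurable_fun setT (\1_(h @^-1` (phi @^-1` [set x])) : T -> R).
  apply: measurable_indic; rewrite -[X in measurable X]setTI; exact: mh.
have expand (K : T -> R) : measurable_fun setT K -> (forall w, 0 <= K w) ->
    (\int[P]_w (K w * phi (h w))%:E = \sum_(x \in range phi)
       x%:E * \int[P]_w (K w * \1_(h @^-1` (phi @^-1` [set x])) w)%:E)%E.
  move=> mK K0.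
  have ge0 (x : R) (w : T) :
      (0 <= (x * (K w * \1_(h @^-1` (phi @^-1` [set x])) w))%:E)%E.
    rewrite lee_fin mulrCA mulr_ge0//.
    exact: (nnfun_muleindic_ge0 phi x (h w)).
  transitivity (\int[P]_w \sum_(x \in range phi)
       (x * (K w * \1_(h @^-1` (phi @^-1` [set x])) w))%:E)%E.
    apply: eq_integral => w _.
    rewrite fsumEFin//; congr (_%:E).
    rewrite [in LHS](fimfunE phi) mulrC mulr_fsuml//.
    apply: eq_fsbigr => x _; rewrite -mulrA [_ * K w]mulrC//.
  rewrite ge0_integral_fsum//; last first.
    move=> x; apply/measurable_EFinP.
    by apply: measurable_funM => //; apply: measurable_funM.
  apply: eq_fsbigr => x /set_mem[z _ xE].
  have x0 : 0 <= x by rewrite -xE.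
  under eq_integral do rewrite EFinM.
  rewrite ge0_integralZl//; first by apply/measurable_EFinP; exact: measurable_funM.
  by move=> w _; rewrite lee_fin mulr_ge0.
rewrite !expand//.
apply: eq_fsbigr => x _; congr (_ * _)%E.
rewrite hB//.
under eq_integral do rewrite EFinM.
rewrite ge0_integralZl//; last exact/measurable_EFinP.
by rewrite integral_indic ?setIT// -[X in measurable X]setTI; exact: mh.
Qed.

(** Monotone convergence extends the product formula from simple functions of
    [h] to [h] itself.  The hypothesis only speaks of events of the form
    [h^-1 B] and of a fixed [H], so that the lemma can be used to replace
    indicators by functions one factor at a time. *)
Lemma integral_mul_factor (H h : T -> R) (c : R) :
  measurable_fun setT H -> measurable_fun setT h ->
  (forall w, 0 <= H w) -> (forall w, 0 <= h w) -> 0 <= c ->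
  (forall B, measurable B ->
    (\int[P]_w (H w * \1_(h @^-1` B) w)%:E = c%:E * P (h @^-1` B))%E) ->
  (\int[P]_w (H w * h w)%:E = c%:E * \int[P]_w (h w)%:E)%E.
Proof.
move=> mH mh H0 h0 c0 hB.
have mabs : measurable_fun [set: R] (fun x : R => `|x|%:E).
  by apply/measurable_EFinP; exact: normr_measurable.
pose phi := nnsfun_approx measurableT mabs.
have lim (K : T -> R) : measurable_fun setT K -> (forall w, 0 <= K w) ->
    (\int[P]_w (K w * h w)%:E = limn (fun n => \int[P]_w (K w * phi n (h w))%:E))%E.
  move=> mK K0; rewrite -monotone_convergence//=.
  - apply: eq_integral => w _; apply/esym/cvg_lim => //.
    under eq_fun do rewrite EFinM.
    rewrite EFinM; apply: cvgeZl => //.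
    have abs0 (x : R) : [set: R] x -> (0 <= `|x|%:E)%E by rewrite lee_fin.
    have := cvg_nnsfun_approx measurableT mabs abs0 (I : [set: R] (h w)).
    by rewrite ger0_norm.
  - move=> n; apply/measurable_EFinP; apply: measurable_funM => //.
    exact: measurableT_comp.
  - by move=> n w _; rewrite lee_fin mulr_ge0.
  - move=> w _ a b ab; rewrite lee_fin ler_wpM2l//.
    exact/lefP/(nd_nnsfun_approx measurableT mabs).
rewrite -ge0_integralZl//; [|exact/measurable_EFinP|by move=> w _; rewrite lee_fin].
under [RHS]eq_integral do rewrite -EFinM.
rewrite lim// (lim (cst c))//; congr (limn _); apply/funext => n.
exact: integral_mul_nnsfun.
Qed.
End Factorization.

Section Independence.
Context d (T : measurableType d) (R : realType) (P : probability T R).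

Lemma indic_bigcap_seq (I : eqType) (s : seq I) (A : I -> set T) (w : T) :
  \1_(\bigcap_(x in [set` s]) A x) w = \prod_(x <- s) \1_(A x) w :> R.
Proof.
elim: s => [|x s IH]; first by rewrite classical_sets.set_nil bigcap_set0 big_nil indicT.
rewrite (_ : \bigcap_(y in [set` x :: s]) A y =
  A x `&` \bigcap_(y in [set` s]) A y); last first.
  rewrite -bigcap_setU1; congr bigcap; apply/seteqP; split => y /=; rewrite inE.
    by move=> /predU1P.
  by move=> h; apply/predU1P.
by rewrite indicI/= big_cons IH.
Qed.

(** The product of expectations for mutually independent variables.  Mutual
    independence is the case where all factors are indicators; the induction
    turns one indicator at a time into a function, [s1] listing the factors that
    are already functions and [s2] those that are still indicators. *)
Lemma integral_prod_indep (I : eqType) (D : set I) (X : I -> {RV P >-> R})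
    (g : I -> R -> R) (e : I -> R) :
  mutually_independent D X ->
  (forall x, measurable_fun setT (g x)) -> (forall x y, 0 <= g x y) ->
  (forall x, D x -> (\int[P]_w (g x (X x w))%:E = (e x)%:E)%E) ->
  forall s, uniq s -> (forall x, x \in s -> D x) ->
  (\int[P]_w (\prod_(x <- s) g x (X x w))%:E = (\prod_(x <- s) e x)%:E)%E.
Proof.
move=> indep mg g0 ge.
pose prob x (B : set R) := fine (P (X x @^-1` B)).
have mX x (B : set R) : measurable B -> measurable (X x @^-1` B).
  by move=> mB; rewrite -[X in measurable X]setTI; exact: (measurable_funPT (X x)).
have probE x B : measurable B -> P (X x @^-1` B) = (prob x B)%:E.
  by move=> mB; rewrite fineK// fin_num_measure//; exact: mX.
suff key s1 : forall s2 (B : I -> set R), uniq (s1 ++ s2) ->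
    (forall x, x \in s1 ++ s2 -> D x) -> (forall x, measurable (B x)) ->
    (\int[P]_w (\prod_(x <- s1) g x (X x w) *
               \prod_(x <- s2) \1_(X x @^-1` B x) w)%:E =
     (\prod_(x <- s1) e x * \prod_(x <- s2) prob x (B x))%:E)%E.
  move=> s us sD; have := key s [::] (fun=> setT); rewrite !cats0 => /(_ us sD).
  rewrite big_nil mulr1 => <- //.
  by apply: eq_integral => w _; rewrite big_nil mulr1.
elim: s1 => [|x s1 IH] s2 B us sD mB.
  rewrite big_nil mul1r.
  under eq_integral do rewrite big_nil mul1r -indic_bigcap_seq.
  rewrite integral_indic ?setIT//; last first.
    by apply: fin_bigcap_measurable => // y _; exact: mX.
  apply: (etrans (indep s2 B us sD (fun y _ => mB y))); rewrite (big_morph EFin (@EFinM R) erefl).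
  by apply: eq_bigr => y _; rewrite probE.
have xs2 : x \notin s2 by move: us => /= /andP[]; rewrite mem_cat negb_or => /andP[].
have Dx : D x by apply: sD; rewrite mem_head.
pose H w := \prod_(y <- s1) g y (X y w) * \prod_(y <- s2) \1_(X y @^-1` B y) w.
pose c := \prod_(y <- s1) e y * \prod_(y <- s2) prob y (B y).
have e0 y : D y -> 0 <= e y.
  by move=> Dy; rewrite -lee_fin -ge//; apply: integral_ge0 => w _; rewrite lee_fin.
have s1D y : y \in s1 -> D y by move=> ys; apply: sD; rewrite inE mem_cat ys orbT.
rewrite [RHS](_ : _ = c%:E * \int[P]_w (g x (X x w))%:E)%E; last first.
  by rewrite ge// -EFinM big_cons /c [e x * _]mulrC mulrAC.
under eq_integral => w _ do
  rewrite big_cons -mulrA [X in X%:E]mulrC -/(H w).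
apply: integral_mul_factor.
- apply: measurable_funM.
    apply: measurable_prod => y _.
    by apply: measurableT_comp => //; exact: measurable_funPT.
  by apply: measurable_prod => y _; apply: measurable_indic; exact: mX.
- by apply: measurableT_comp => //; exact: measurable_funPT.
- by move=> w; rewrite mulr_ge0// prodr_ge0.
- by [].
- rewrite mulr_ge0//; last by apply: prodr_ge0 => y _; rewrite fine_ge0.
  by rewrite big_seq; apply: prodr_ge0 => y /s1D/e0.
- move=> A mA.
  pose A' := g x @^-1` A.
  have mA' : measurable A' by rewrite -[A']setTI; exact: mg.
  pose B' y := if y == x then A' else B y.
  have B'x : B' x = A' by rewrite /B' eqxx.
  have sB' (F : I -> set R -> R) :
      \prod_(y <- s2) F y (B' y) = \prod_(y <- s2) F y (B y).
    rewrite big_seq [RHS]big_seq; apply: eq_bigr => y ys.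
    by rewrite /B'; case: eqP => // yx; rewrite -yx ys in xs2.
  have us' : uniq (s1 ++ x :: s2).
    by rewrite (perm_uniq (permEl (perm_catCA s1 [:: x] s2))).
  have sD' y : y \in s1 ++ x :: s2 -> D y.
    by rewrite (perm_mem (permEl (perm_catCA s1 [:: x] s2))); exact: sD.
  have mB' y : measurable (B' y) by rewrite /B'; case: ifP.
  have := IH (x :: s2) B' us' sD' mB'.
  rewrite big_cons (sB' prob) B'x => IHx.
  rewrite (_ : P _ = (prob x A')%:E); last exact: probE.
  rewrite -EFinM /c -mulrA [_ * prob x A']mulrC -IHx.
  apply: eq_integral => w _; congr (_%:E).
  rewrite big_cons (sB' (fun y C => \1_(X y @^-1` C) w)) B'x /H.
  by rewrite -mulrA [_ * \1__ w]mulrC.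
Qed.

(** Independence of set systems is used twice: it turns first [H], then [h], from
    an indicator into a function. *)
Lemma integral_mul_systems (F G : set_system T) (H h : T -> R) (c : R) :
  independent_systems P F G ->
  measurable_fun setT H -> measurable_fun setT h ->
  (forall B, measurable B -> G (H @^-1` B)) ->
  (forall B, measurable B -> F (h @^-1` B)) ->
  (forall w, 0 <= H w) -> (forall w, 0 <= h w) -> 0 <= c ->
  (\int[P]_w (H w)%:E = c%:E)%E ->
  (\int[P]_w (H w * h w)%:E = c%:E * \int[P]_w (h w)%:E)%E.
Proof.
move=> FG mH mh GH Fh H0 h0 c0 Hc.
have pre (g : T -> R) B : measurable_fun setT g -> measurable B ->
    measurable (g @^-1` B) by move=> mg mB; rewrite -[X in measurable X]setTI; exact: mg.
apply: integral_mul_factor => // B mB.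
have mhB := pre _ _ mh mB.
have PE : P (h @^-1` B) = (fine (P (h @^-1` B)))%:E.
  by rewrite fineK// fin_num_measure.
under eq_integral do rewrite mulrC.
rewrite (@integral_mul_factor _ _ _ _ (\1_(h @^-1` B)) H (fine (P (h @^-1` B))))//.
- by rewrite -PE Hc muleC.
- exact: fine_ge0.
- move=> A mA; under eq_integral do rewrite -[_ * _]/((\1__ \* \1__) _) -indicI.
  rewrite integral_indic ?setIT//; last by apply: measurableI => //; exact: pre.
  by apply: etrans (FG _ _ (Fh _ mB) (GH _ mA)) _; rewrite -PE.
Qed.
End Independence.

(** * The exponential supermartingale of the rewards of an arm *)

(** The bound on the logarithm also shows that the moment generating function is
    finite, since [lne +oo = +oo]. *)
Lemma sub_gaussian_mgf_le1 d (T : measurableType d) (R : realType)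
    (P : probability T R) (sigma mu : R) (X : {RV P >-> R}) (beta : R) :
  sub_gaussian sigma mu X ->
  (\int[P]_w (expR (beta * (X w - mu) - (sigma * beta) ^+ 2 / 2))%:E <= 1)%E.
Proof.
move=> [_ /(_ beta)].
set y := (_ + _ : R) => hlne.
have mgf_ge0 : (0 <= mmt_gen_fun P X beta)%E.
  by rewrite /mmt_gen_fun unlock; apply: integral_ge0 => w _; rewrite lee_fin expR_ge0.
have mgf_le : (mmt_gen_fun P X beta <= (expR y)%:E)%E.
  move: hlne mgf_ge0; case: (mmt_gen_fun P X beta) => [z| |] //=.
  case: ifPn => [z0 _ _|]; first by rewrite lee_fin (le_trans z0)// expR_ge0.
  rewrite -ltNge !lee_fin => z0 zy _.
  by rewrite -[z]lnK ?posrE// ler_expR.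
rewrite (_ : (\int[P]_w _)%E = (expR (- y))%:E * mmt_gen_fun P X beta)%E; last first.
  rewrite /mmt_gen_fun unlock -ge0_integralZl//.
  - by apply: eq_integral => w _; rewrite -EFinM -expRD /=; congr (expR _)%:E;
      rewrite /y; field.
  - apply/measurable_EFinP; apply: measurableT_comp => //.
  - by move=> w _; rewrite lee_fin expR_ge0.
apply: (le_trans (lee_wpmul2l _ mgf_le)); first by rewrite lee_fin expR_ge0.
by rewrite -EFinM -expRD addNr expR0.
Qed.

Section RewardSupermartingale.
Context d (Omega : measurableType d) (R : realType) (P : probability Omega R).
Context (M N : nat).
Context (r : 'I_N -> 'I_M -> nat -> {RV P >-> R}).
Context (act : 'I_M -> nat -> Omega -> 'I_N).
Context (m : 'I_N -> R) (sigma : R).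
Context (model : reward_model r act m sigma).
Context (mact : forall k t i, (0 < t)%N -> measurable (act k t @^-1` [set i])).
Context (j : 'I_N) (b : nat -> 'I_M -> R).

Definition selected (k : 'I_M) (t : nat) (w : Omega) : R := (act k t w == j)%:R.

(** The exponent contributed by the reward [x] with tilt [b t k]; the subtracted
    term is the sub-Gaussian bound on the log-moment generating function, so that
    the expectation of its exponential is at most 1. *)
Definition gain (t : nat) (k : 'I_M) (x : R) : R :=
  b t k * (x - m j) - (sigma * b t k) ^+ 2 / 2.

Definition log_supermartingale (t : nat) (w : Omega) : R :=
  \sum_(1 <= s < t.+1) \sum_k selected k s w * gain s k (r j k s w).

Lemma selectedE k t : selected k t = \1_(act k t @^-1` [set j]).
Proof.
by apply/funext => w; rewrite indicE; congr ((nat_of_bool _)%:R); apply/eqP/idP => [?|/set_mem//];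
  exact: mem_set.
Qed.

Lemma measurable_gain t k : measurable_fun setT (gain t k).
Proof.
apply: measurable_funB => //; apply: measurable_funM => //.
exact: measurable_funB.
Qed.

(** A reward of the arm enters only if the arm is played, and then it is the
    reward received.  This is what makes the sum measurable with respect to the
    history. *)
Lemma log_supermartingale_received t : log_supermartingale t = fun w =>
  \sum_(1 <= s < t.+1) \sum_k selected k s w * gain s k (received r act k s w).
Proof.
apply/funext => w; apply: eq_bigr => s _; apply: eq_bigr => k _; rewrite /selected /received.
by case: eqP => [->//|_]; rewrite !mul0r.
Qed.

(** Stated over an arbitrary measurable structure, as it is needed both for the
    ambient sigma-algebra and for the history. *)
Lemma measurable_sum_gain d' (T : measurableType d') (S Y : 'I_M -> nat -> T -> R) t :
  (forall k s, (0 < s <= t)%N -> measurable_fun setT (S k s)) ->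
  (forall k s, (0 < s <= t)%N -> measurable_fun setT (Y k s)) ->
  measurable_fun setT
    (fun w => \sum_(1 <= s < t.+1) \sum_k S k s w * gain s k (Y k s w)).
Proof.
move=> mS mY.
under eq_fun do rewrite big_seq.
under eq_fun do rewrite big_mkcond/=.
apply: measurable_sum => s; rewrite mem_index_iota ltnS.
case: (boolP (0 < s <= t)%N) => // st; apply: measurable_sum => k.
apply: measurable_funM; first exact: mS.
by apply: measurableT_comp; [exact: measurable_gain|exact: mY].
Qed.

Lemma measurable_selected k t : (0 < t)%N ->
  measurable_fun [set: Omega] (selected k t).
Proof. by move=> t0; rewrite selectedE; apply: measurable_indic; exact: mact. Qed.

Lemma measurable_log_supermartingale t :
  measurable_fun [set: Omega] (log_supermartingale t).
Proof.
apply: measurable_sum_gain => k s /andP[s0 _]; first exact: measurable_selected.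
exact: measurable_funPT.
Qed.

Definition played (t : nat) (w : Omega) : {set 'I_M} := [set k | act k t w == j]%SET.

(** The product form shows that the event depends measurably on the selections. *)
Lemma playedE t w (B : {set 'I_M}) : (played t w == B)%:R =
  \prod_k (if k \in B then selected k t w else 1 - selected k t w) :> R.
Proof.
case: eqP => [<-|/eqP pB]; last first.
  have [k kP] : exists k, (k \in played t w) != (k \in B).
    apply/existsP; apply: contraNT pB; rewrite negb_exists => /forallP h.
    by apply/eqP/setP => k; apply/eqP; move: (h k); rewrite negbK.
  rewrite (bigD1 k)//= [X in X * _](_ : _ = 0) ?mul0r//.
  by move: kP; rewrite inE /selected; case: (k \in B);
    case: (act k t w == j) => //=; rewrite subrr.
rewrite big1// => k _; by rewrite inE /selected; case: (act k t w == j); rewrite ?subr0.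
Qed.

Lemma measurable_played d' (T : measurableType d') (S : 'I_M -> T -> R) (B : {set 'I_M}) :
  (forall k, measurable_fun setT (S k)) ->
  measurable_fun setT (fun w => \prod_k (if k \in B then S k w else 1 - S k w)).
Proof.
move=> mS; apply: measurable_prod => k _; case: (k \in B) => //.
exact: measurable_funB.
Qed.

(** The generators of [history]: equipping the sample space with the
    sigma-algebra they generate turns membership in the history into
    measurability of functions. *)
Definition history_gens (t : nat) : set_system Omega :=
  (\bigcup_(s in [set s | (0 < s < t)%N]) \bigcup_k
         preimage_set_system setT (received r act k s) measurable)
      `|`
  (\bigcup_(s in [set s | (0 < s <= t)%N]) \bigcup_k
         preimage_set_system setT (act k s) setT).

Lemma measurable_past_weight t (B : {set 'I_M}) (C : set R) : measurable C ->
  history r act t.+1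
    ((fun w => expR (log_supermartingale t w) * (played t.+1 w == B)%:R) @^-1` C).
Proof.
move=> mC.
pose T' := g_sigma_algebraType (history_gens t.+1).
have msel k s : (0 < s <= t.+1)%N -> measurable_fun [set: T'] (selected k s).
  move=> hs; rewrite selectedE; apply: measurable_indic.
  apply: sub_sigma_algebra; right; exists s => //; exists k => //.
  by exists [set j] => //; rewrite setTI.
have mrec k s : (0 < s <= t)%N -> measurable_fun [set: T'] (received r act k s).
  move=> hs _ A mA; apply: sub_sigma_algebra; left; exists s => //; exists k => //.
  by exists A.
suff : measurable_fun [set: T']
    (fun w => expR (log_supermartingale t w) * (played t.+1 w == B)%:R).
  by move=> /(_ measurableT _ mC); rewrite setTI.
apply: measurable_funM.
  apply: measurableT_comp; first exact: measurable_expR.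
  rewrite log_supermartingale_received.
  apply: measurable_sum_gain mrec => k s /andP[s0 st].
  by apply: msel; rewrite s0 ltnW.
under eq_fun do rewrite playedE.
by apply: measurable_played => k; apply: msel; rewrite ltnSn.
Qed.

Lemma measurable_current_gain t (B : {set 'I_M}) (C : set R) : measurable C ->
  rewards_at r t ((fun w => \prod_(k in B) expR (gain t k (r j k t w))) @^-1` C).
Proof.
move=> mC.
pose T' := g_sigma_algebraType
  (\bigcup_i \bigcup_k preimage_set_system setT (r i k t) measurable).
suff : measurable_fun [set: T'] (fun w => \prod_(k in B) expR (gain t k (r j k t w))).
  by move=> /(_ measurableT _ mC); rewrite setTI.
rewrite (_ : (fun w => _) = fun w =>
    \prod_k (if k \in B then expR (gain t k (r j k t w)) else 1)); last first.
  by apply/funext => w; rewrite big_mkcond.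
apply: measurable_prod => k _; case: (k \in B) => //.
apply: measurableT_comp; first exact: measurable_expR.
apply: measurableT_comp; first exact: measurable_gain.
move=> _ A mA; apply: sub_sigma_algebra; exists j => //; exists k => //; by exists A.
Qed.

Lemma integral_current_gain_le1 t (B : {set 'I_M}) : (0 < t)%N ->
  (\int[P]_w (\prod_(k in B) expR (gain t k (r j k t w)))%:E <= 1)%E.
Proof.
move=> t0.
pose I := ('I_M * nat)%type.
pose e (kt : I) := fine (\int[P]_w (expR (gain kt.2 kt.1 (r j kt.1 kt.2 w)))%:E).
have le1 (kt : I) : (0 < kt.2)%N ->
    (\int[P]_w (expR (gain kt.2 kt.1 (r j kt.1 kt.2 w)))%:E <= 1)%E.
  by move=> kt0; apply: sub_gaussian_mgf_le1; exact: (rm_sub_gaussian model).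
have ge0 (kt : I) :
    (0 <= \int[P]_w (expR (gain kt.2 kt.1 (r j kt.1 kt.2 w)))%:E)%E.
  by apply: integral_ge0 => w _; rewrite lee_fin expR_ge0.
have fin (kt : I) : (0 < kt.2)%N ->
    (\int[P]_w (expR (gain kt.2 kt.1 (r j kt.1 kt.2 w)))%:E = (e kt)%:E)%E.
  move=> kt0; rewrite fineK// ge0_fin_numE//.
  by apply: le_lt_trans (le1 _ kt0) _; rewrite ltry.
pose s := [seq (k, t) | k <- enum B].
have us : uniq s by rewrite map_inj_uniq ?enum_uniq// => k k' [].
have s0 kt : kt \in s -> (0 < kt.2)%N by move=> /mapP[k _ ->].
have := @integral_prod_indep _ _ _ P I _ _
  (fun kt x => expR (gain kt.2 kt.1 x)) e (rm_indep model j) _ _ fin s us s0.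
have mg (kt : I) : measurable_fun setT (fun x => expR (gain kt.2 kt.1 x)).
  by apply: measurableT_comp; [exact: measurable_expR|exact: measurable_gain].
move=> /(_ mg (fun _ _ => expR_ge0 _)) prodE.
rewrite (_ : (\int[P]_w _)%E = (\prod_(x <- s) e x)%:E).
  rewrite lee_fin big_seq; apply: Num.Theory.prodr_ile1 => x /s0 x0.
  by rewrite fine_ge0//= -lee_fin -fin// le1.
rewrite -prodE; apply: eq_integral => w _; congr _%:E.
by rewrite big_map big_enum_cond; apply: eq_bigl => k; rewrite andbT.
Qed.

(** The agents that play the arm in the new round are random but known before
    its rewards.  Splitting according to their set [B], the increment is a
    product of independent factors indexed by [B], each of expectation at most
    1, and it is independent of the past and of the event that [B] is played. *)
Lemma integral_log_supermartingale_le1 t :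
  (\int[P]_w (expR (log_supermartingale t w))%:E <= 1)%E.
Proof.
have mlog s := measurable_log_supermartingale s.
have mexp s : measurable_fun [set: Omega] (fun w => expR (log_supermartingale s w)).
  by apply: measurableT_comp; first exact: measurable_expR.
elim: t => [|t IH].
  under eq_integral do rewrite /log_supermartingale big_nil expR0.
  by rewrite integral_cst// mul1e; exact: probability_le1.
pose H B w : R := expR (log_supermartingale t w) * (played t.+1 w == B)%:R.
pose h (B : {set 'I_M}) w : R := \prod_(k in B) expR (gain t.+1 k (r j k t.+1 w)).
have mH B : measurable_fun setT (H B).
  apply: measurable_funM => //; under eq_fun do rewrite playedE.
  by apply: measurable_played => k; exact: measurable_selected.
have mh B : measurable_fun setT (h B).
  rewrite (_ : h B = fun w =>
    \prod_k (if k \in B then expR (gain t.+1 k (r j k t.+1 w)) else 1)); last first.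
    by apply/funext => w; rewrite /h big_mkcond.
  apply: measurable_prod => k _; case: (k \in B) => //.
  apply: measurableT_comp; first exact: measurable_expR.
  by apply: measurableT_comp; first exact: measurable_gain.
have H0 B w : 0 <= H B w by rewrite mulr_ge0// expR_ge0.
have h0 B w : 0 <= h B w by rewrite prodr_ge0// => k _; exact: expR_ge0.
rewrite (_ : (\int[P]_w _)%E = \sum_(B : {set 'I_M}) \int[P]_w (H B w * h B w)%:E)%E;
    last first.
  rewrite -ge0_integral_sum//; last 2 first.
  - by move=> B; apply/measurable_EFinP; exact: measurable_funM.
  - by move=> B w _; rewrite lee_fin mulr_ge0.
  apply: eq_integral => w _; rewrite sumEFin; congr _%:E.
  rewrite (bigD1 (played t.+1 w))//= big1 ?addr0; last first.
    by move=> B; rewrite eq_sym /H => /negPf->; rewrite mulr0 mul0r.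
  rewrite /H eqxx mulr1 /log_supermartingale big_nat_recr//= expRD; congr (_ * _).
  rewrite expR_sum /h [RHS]big_mkcond; apply: eq_bigr => k _; rewrite inE.
  by rewrite /selected; case: ifP => _; rewrite ?mul1r// mul0r expR0.
apply: (le_trans _ IH).
rewrite [leRHS](_ : _ = \sum_(B : {set 'I_M}) \int[P]_w (H B w)%:E)%E; last first.
  rewrite -ge0_integral_sum//; last 2 first.
  - by move=> B; exact/measurable_EFinP.
  - by move=> B w _; rewrite lee_fin.
  apply: eq_integral => w _; rewrite sumEFin; congr _%:E.
  rewrite (bigD1 (played t.+1 w))//= big1 ?addr0; last first.
    by move=> B; rewrite eq_sym /H => /negPf->; rewrite mulr0.
  by rewrite /H eqxx mulr1.
apply: lee_sum => B _.
have HB_ge0 : (0 <= \int[P]_w (H B w)%:E)%E.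
  by apply: integral_ge0 => w _; rewrite lee_fin.
have HB_fin : (\int[P]_w (H B w)%:E = (fine (\int[P]_w (H B w)%:E))%:E)%E.
  rewrite fineK// ge0_fin_numE//.
  apply: (@le_lt_trans _ _ 1%E); last by rewrite ltry.
  apply: le_trans IH; apply: ge0_le_integral => //.
  - by move=> w _; rewrite lee_fin.
  - exact/measurable_EFinP.
  - exact/measurable_EFinP.
  - move=> w _; rewrite lee_fin /H ler_piMr ?expR_ge0//.
    by case: (_ == _).
rewrite (@integral_mul_systems _ _ _ _ _ _ (H B) (h B) _ (rm_past model (ltn0Sn t))
  (mH B) (mh B) _ _ (H0 B) (h0 B) _ HB_fin).
- rewrite HB_fin -[leRHS]mule1; apply: lee_wpmul2l; last exact: integral_current_gain_le1.
  by rewrite -HB_fin.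
- by move=> C mC; exact: measurable_past_weight.
- by move=> C mC; exact: measurable_current_gain.
- exact: fine_ge0.
Qed.

End RewardSupermartingale.

(** * Peeling and confidence widths *)

Section Peeling.
Context (R : realType).
Implicit Types (eta gamma sigma L c x Y Z V : R).

Lemma G_gt0 eta : 0 < eta < 4 -> 0 < G eta.
Proof. by move=> /andP[e0 e4]; rewrite /G; nra. Qed.

(** The geometric center of a layer of ratio [1 + eta] is at a ratio of at most
    [(1 + eta) ^ (1/2)] from any point of it, hence [(1 + eta) ^ (1/4)] after a
    square root, and [(1 + eta) ^ (1/4) <= 1 + eta / 4]. *)
Lemma layer_center_dist eta x : 0 < eta ->
  `|ln x| <= ln (1 + eta) / 4 -> 0 < x -> `|x - 1| <= eta / 4.
Proof.
move=> e0 + x0; rewrite ler_norml => /andP[lo hi].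
rewrite -[x]lnK ?posrE//; rewrite ler_norml; apply/andP; split.
  have := expR_ge1Dx (ln x).
  have : ln (1 + eta) <= eta by apply: le_ln1Dx; lra.
  lra.
rewrite lerBlDl; apply: (@le_trans _ _ (expR (ln (1 + eta) / 4))).
  by rewrite ler_expR.
rewrite -(@ler_pXn2r _ 4) ?nnegrE ?expR_ge0//; last lra.
rewrite -expRM_natl mulrCA mulfV// mulr1 lnK ?posrE; last lra.
have -> : (1 + eta / 4) ^+ 4 =
    1 + eta + (3 / 8 * eta ^+ 2 + eta ^+ 3 / 16 + eta ^+ 4 / 256) by field.
rewrite lerDl; have := exprn_ge0 2 (ltW e0); have := exprn_ge0 3 (ltW e0).
have := exprn_ge0 4 (ltW e0); lra.
Qed.

Definition layers eta (s : nat) : nat := (Num.truncn (ln s%:R / ln (1 + eta))).+1.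

(** The deviation level, in units of the square root of the variance proxy; it
    solves [deviation ^+ 2 * G eta / (2 * sigma ^+ 2) = gamma * ln s]. *)
Definition deviation sigma gamma eta (s : nat) : R :=
  sigma * Num.sqrt (2 * gamma * ln s%:R / G eta).

(** [deviation / (sigma ^+ 2 * sqrt y)], where [y = c * (1 + eta) ^ (l + 1/2)] is
    the geometric center of the layer number [l] above [c]. *)
Definition tilt sigma gamma eta c (s l : nat) : R :=
  deviation sigma gamma eta s / sigma ^+ 2 *
  expR (- ((ln c + ln (1 + eta) * (l%:R + 2^-1)) / 2)).

Lemma layers_le eta s : 0 < eta -> (0 < s)%N ->
  (layers eta s)%:R <= ln s%:R / ln (1 + eta) + 1.
Proof.
move=> e0 s0; rewrite /layers -natr1 lerD2r truncn_le//.
rewrite divr_ge0// ln_ge0// ?ler1n//; lra.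
Qed.

(** Let [x] be the square root of the ratio of [Y] to the center of its layer.
    The exponent obtained with the tilt of that layer is at least
    [(deviation / sigma) ^+ 2 * (x - x ^+ 2 / 2)], and
    [x - x ^+ 2 / 2 = (1 - (x - 1) ^+ 2) / 2 >= G eta / 2] because
    [`|x - 1| <= eta / 4]. *)
Lemma peeling sigma gamma eta c s Y V Z :
  0 < sigma -> 0 < gamma -> 0 < eta < 4 -> 0 < c -> (0 < s)%N ->
  c <= Y <= c * s%:R -> V <= Y ->
  deviation sigma gamma eta s * Num.sqrt Y <= Z ->
  exists2 l, (l < layers eta s)%N &
    let beta := tilt sigma gamma eta c s l in
    gamma * ln s%:R <= beta * Z - (sigma * beta) ^+ 2 / 2 * V.
Proof.
move=> s0 g0 eta4 c0 n0 /andP[cY Ycs] VY dZ.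
have G0 := G_gt0 eta4.
have /andP[e0 _] := eta4.
have ell0 : 0 < ln (1 + eta) by rewrite ln_gt0; lra.
have Y0 : 0 < Y by lra.
have n0' : 0 < s%:R :> R by rewrite ltr0n.
have lns0 : 0 <= ln s%:R :> R by rewrite ln_ge0 // ler1n.
set ell := ln (1 + eta) in ell0 *.
have lncY : ln c <= ln Y by rewrite ler_ln ?posrE.
have lnYs : ln Y <= ln c + ln s%:R by rewrite -lnM ?posrE// ler_ln ?posrE// mulr_gt0.
pose z := (ln Y - ln c) / ell.
have z0 : 0 <= z by rewrite divr_ge0//; lra.
have /andP[lz zl] : (Num.truncn z)%:R <= z < (Num.truncn z).+1%:R.
  by rewrite truncn_itv.
exists (Num.truncn z).
  rewrite /layers ltnS le_truncn// /z ler_wpM2r ?invr_ge0 ?(ltW ell0)//; lra.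
move: lz zl; rewrite -natr1; set l : R := (Num.truncn z)%:R => lz zl.
move: lz; rewrite /z ler_pdivlMr// => lz.
move: zl; rewrite /z ltr_pdivrMr// => zl.
rewrite /tilt /= -/ell -/l.
set h := (ln c + ell * (l + 2^-1)) / 2.
set D := deviation _ _ _ _ in dZ *.
have D0 : 0 <= D by rewrite mulr_ge0 ?sqrtr_ge0 ?ltW.
have D2 : D ^+ 2 = sigma ^+ 2 * (2 * gamma * ln s%:R / G eta).
  by rewrite exprMn sqr_sqrtr// divr_ge0 ?(ltW G0)// !mulr_ge0// ltW.
have sqY : Num.sqrt Y = expR (ln Y / 2).
  have -> : Y = expR (ln Y / 2) ^+ 2.
    by rewrite -expRM_natl mulrCA mulfV// mulr1 lnK ?posrE.
  rewrite sqrtr_sqr ger0_norm ?expR_ge0// !lnXn ?expR_gt0// expRK.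
  by congr expR; rewrite -mulr_natr; field.
pose x := expR (ln Y / 2 - h).
have xG : G eta <= 1 - (x - 1) ^+ 2.
  have : `|x - 1| <= eta / 4.
    apply: layer_center_dist; rewrite ?expR_gt0// expRK ler_norml /h -/ell.
    by apply/andP; split; lra.
  rewrite ler_norml /G => /andP[]; nra.
have bZ : D / sigma ^+ 2 * expR (- h) * Z >= D ^+ 2 / sigma ^+ 2 * x.
  rewrite /x expRD -sqY.
  have -> : D ^+ 2 / sigma ^+ 2 * (Num.sqrt Y * expR (- h)) =
    D / sigma ^+ 2 * expR (- h) * (D * Num.sqrt Y) by ring.
  by rewrite ler_wpM2l// mulr_ge0 ?expR_ge0// divr_ge0 ?sqr_ge0.
have bV : (sigma * (D / sigma ^+ 2 * expR (- h))) ^+ 2 / 2 * V <=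
    D ^+ 2 / sigma ^+ 2 * (x ^+ 2 / 2).
  apply: le_trans (ler_wpM2l _ VY) _; first by rewrite divr_ge0// sqr_ge0.
  rewrite le_eqVlt; apply/orP; left; apply/eqP.
  rewrite /x expRD -sqY -[in LHS](sqr_sqrtr (ltW Y0)); field; lra.
apply: le_trans (lerB bZ bV).
have -> : gamma * ln s%:R = D ^+ 2 / sigma ^+ 2 * (G eta / 2).
  by rewrite D2; field; rewrite !gt_eqF.
rewrite -mulrBr ler_wpM2l ?divr_ge0 ?sqr_ge0//; lra.
Qed.

(** Squaring the hypothesis gives [n ^+ 2 < 2 B (n + phi)] with
    [B = 4 sigma ^+ 2 gamma LT / (Delta ^+ 2 * G eta) / M], so [n] is smaller than
    the positive root [B (1 + sqrt (1 + 2 phiT / B))]. *)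
Lemma confidence_width_quadratic sigma gamma eta (M : nat) (Delta n phi phiT L LT : R) :
  0 < sigma -> 0 < gamma -> 0 < G eta -> (0 < M)%N -> 0 < Delta ->
  0 <= n -> 0 <= phi <= phiT -> 0 <= L <= LT -> 0 < LT ->
  Delta * n < 2 * (sigma * Num.sqrt (2 * gamma / G eta * ((n + phi) / M%:R) * L)) ->
  n * M%:R < 4 * sigma ^+ 2 * gamma * LT / (Delta ^+ 2 * G eta) *
   (1 + Num.sqrt (1 + Delta ^+ 2 * M%:R * G eta / (2 * gamma * sigma ^+ 2) * (phiT / LT))).
Proof.
move=> s0 g0 G0 M0 D0 n0 /andP[p0 pT] /andP[L0 LLT] LT0 hlt.
have {}M0 : 0 < M%:R :> R by rewrite ltr0n.
pose B := 4 * sigma ^+ 2 * gamma * LT / (Delta ^+ 2 * G eta) / M%:R.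
have B0 : 0 < B by rewrite !(divr_gt0, mulr_gt0, exprn_gt0).
have -> : 4 * sigma ^+ 2 * gamma * LT / (Delta ^+ 2 * G eta) = B * M%:R.
  by rewrite /B divfK ?gt_eqF.
have -> : Delta ^+ 2 * M%:R * G eta / (2 * gamma * sigma ^+ 2) * (phiT / LT) = 2 * phiT / B.
  by rewrite /B; field; rewrite !gt_eqF.
rewrite mulrAC ltr_pM2r//.
set A := 2 * gamma / G eta * _ * L in hlt.
have g' : 0 <= 2 * gamma / G eta by rewrite divr_ge0 ?mulr_ge0 ?ltW.
have nM : 0 <= (n + phi) / M%:R by rewrite divr_ge0 ?addr_ge0// ltW.
have A0 : 0 <= A by rewrite mulr_ge0// mulr_ge0.
have nsq : n ^+ 2 < 2 * B * (n + phiT).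
  have : (Delta * n) ^+ 2 < (2 * (sigma * Num.sqrt A)) ^+ 2.
    rewrite ltr_pXn2r ?nnegrE//; first by rewrite mulr_ge0// ltW.
    by rewrite !mulr_ge0 ?sqrtr_ge0// ltW.
  rewrite !exprMn sqr_sqrtr//; move: hlt => _ hlt.
  have AT : A <= 2 * gamma / G eta * ((n + phiT) / M%:R) * LT.
    rewrite ler_pM//; first by rewrite mulr_ge0.
    by rewrite ler_wpM2l// ler_wpM2r ?invr_ge0 ?(ltW M0)// lerD2l.
  have D2 : 0 < Delta ^+ 2 by rewrite exprn_gt0.
  rewrite -(ltr_pM2l D2); apply: lt_le_trans hlt _.
  have -> : Delta ^+ 2 * (2 * B * (n + phiT)) =
    2 ^+ 2 * (sigma ^+ 2 * (2 * gamma / G eta * ((n + phiT) / M%:R) * LT)).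
    by rewrite /B; field; rewrite !gt_eqF.
  by rewrite !ler_wpM2l ?sqr_ge0.
set r := Num.sqrt _.
have r2 : r ^+ 2 = 1 + 2 * phiT / B.
  by rewrite sqr_sqrtr// addr_ge0// divr_ge0 ?(ltW B0)// mulr_ge0//; lra.
have r0 : 0 <= r by exact: sqrtr_ge0.
rewrite ltNge; apply/negP => hn.
have : (B * r) ^+ 2 <= (n - B) ^+ 2.
  rewrite ler_pXn2r ?nnegrE ?mulr_ge0 ?(ltW B0)//; nra.
have -> : (B * r) ^+ 2 = B ^+ 2 + 2 * B * phiT.
  by rewrite exprMn r2; field; rewrite gt_eqF.
nra.
Qed.
End Peeling.

(** * Sums over the rounds *)

Section Series.
Context (R : realType).
Implicit Types (a c x L : R) (n s : nat).

Lemma ln_step s : (1 < s)%N -> s%:R^-1 <= ln s%:R - ln s.-1%:R :> R.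
Proof.
case: s => [|[|s]]// _ /=.
have s1 : 0 < s.+1%:R :> R by rewrite ltr0n.
have s2 : 0 < s.+2%:R :> R by rewrite ltr0n.
have : ln (1 + - s.+2%:R^-1) <= - s.+2%:R^-1 :> R.
  by apply: le_ln1Dx; rewrite ltrN2 invf_lt1// ltr1n.
have -> : 1 + - s.+2%:R^-1 = s.+1%:R / s.+2%:R :> R.
  by rewrite -(natr1 s.+1); field; apply: lt0r_neq0; have := ler0n R s; lra.
by rewrite ln_div ?posrE// -[in X in _ -> X]lerN2 opprB.
Qed.

Lemma expRN_ln x : 0 < x -> expR (- ln x) = x^-1.
Proof. by move=> x0; rewrite expRN lnK. Qed.

(** [s ^ - (1 + a) <= ((s - 1) ^ - a - s ^ - a) / a], and the right-hand sides
    telescope. *)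
Lemma sum_expRN_ln_le a n : 0 < a ->
  \sum_(2 <= s < n) expR (- ((1 + a) * ln s%:R)) <= a^-1.
Proof.
move=> a0.
suff key k : \sum_(2 <= s < k.+2) expR (- ((1 + a) * ln s%:R)) <=
    (1 - expR (- (a * ln k.+1%:R))) / a.
  have [n2|] := leqP n 2; first by rewrite big_geq// invr_ge0 ltW.
  case: n => [|[|n]]// _; apply: le_trans (key n) _.
  by rewrite ler_pdivrMr// mulVf ?gt_eqF// lerBlDr lerDl expR_ge0.
elim: k => [|k IH]; first by rewrite big_geq// ln1 mulr0 oppr0 expR0 subrr mul0r.
rewrite big_nat_recr//=; apply: le_trans (lerD IH (lexx _)) _.
have step := @ln_step k.+2 isT; rewrite /= in step.
set l := ln k.+1%:R in step *; set L := ln k.+2%:R in step *.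
have EL : expR (- L) = k.+2%:R^-1 by rewrite expRN_ln// ltr0n.
have -> : - ((1 + a) * L) = - L + - (a * L) by ring.
have -> : - (a * l) = a * (L - l) + - (a * L) by ring.
rewrite !expRD EL.
have h : 1 + a * k.+2%:R^-1 <= expR (a * (L - l)).
  apply: le_trans (expR_ge1Dx _); rewrite lerD2l ler_pM2l//.
have E0 := expR_gt0 (- (a * L)).
rewrite -lerBrDl -mulrBl ler_pdivlMr//.
have := ler_wpM2r (ltW E0) h.
set X := expR _; set E := expR _; set z := _^-1; lra.
Qed.

(** [e ^ (1/8) <= 1 / (1 - 1/8) = 8 / 7], and [(8 / 7) ^ 8 < 3]. *)
Lemma expR1_le3 : expR 1 <= 3 :> R.
Proof.
have -> : expR 1 = expR (8%:R^-1) ^+ 8 :> R by rewrite -expRM_natl mulfV.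
have h : expR 8%:R^-1 <= 8 / 7 :> R.
  have := expR_ge1Dx (- 8%:R^-1 : R); rewrite expRN => h.
  rewrite -[leLHS]invrK -[leRHS]invrK lef_pV2 ?posrE ?invr_gt0 ?expR_gt0//; lra.
apply: le_trans (lerXn2r _ _ _ h) _; rewrite ?nnegrE ?expR_ge0//; lra.
Qed.

Lemma nonincreasing_mul_expRN c x L : 1 <= c -> 1 <= x -> x <= L ->
  L * expR (- (c * L)) <= x * expR (- (c * x)).
Proof.
move=> c1 x1 xL.
have -> : - (c * x) = c * (L - x) + - (c * L) by ring.
rewrite expRD mulrA ler_wpM2r ?expR_ge0//.
have xc : 1 <= x * c by rewrite mulr_ege1.
have x0 : 0 <= x by lra.
apply: le_trans (ler_wpM2l x0 (expR_ge1Dx _)).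
have Lx : 0 <= L - x by lra.
have := ler_wpM2r Lx xc; lra.
Qed.

(** [F x = x ^ - a * (ln x / a + 1 / a ^+ 2)] is an antiderivative of
    [- ln x / x ^ (1 + a)].  As [ln x / x ^ (1 + a)] is nonincreasing for
    [x >= 3 >= e], each term with [s >= 4] is at most [F (s - 1) - F s] by the
    mean value theorem, and [F 3 <= 1 / a ^+ 2].  The terms [s = 2] and [s = 3]
    are at most 1/2 each. *)
Lemma sum_ln_expRN_ln_le a n : 0 < a ->
  \sum_(2 <= s < n) ln s%:R * expR (- ((1 + a) * ln s%:R)) <= (a ^+ 2)^-1 + 1.
Proof.
move=> a0.
pose F x : R := expR (- (a * ln x)) * (ln x / a + (a ^+ 2)^-1).
pose t s : R := ln s%:R * expR (- ((1 + a) * ln s%:R)).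
have dF x (x0 : 0 < x) := is_deriveM
    (is_derive1_comp (is_derive_expR ((- a *: @ln R) x)) (is_deriveZ (- a) (is_derive1_ln x0)))
    (is_deriveD (is_deriveZ a^-1 (is_derive1_ln x0)) (is_derive_cst (a ^+ 2)^-1 x 1)).
have F_ge0 s : (0 < s)%N -> 0 <= F s%:R.
  move=> s0; rewrite /F mulr_ge0 ?expR_ge0// addr_ge0 ?invr_ge0 ?sqr_ge0//.
  by rewrite divr_ge0 ?(ltW a0)// ln_ge0// ler1n.
have t_ge0 s : 0 <= t s.
  rewrite mulr_ge0 ?expR_ge0//; case: s => [|s]; first by rewrite ln0.
  by rewrite ln_ge0// ler1n.
have small s : (1 < s)%N -> t s <= 2^-1.
  move=> s1; have s0 : 0 < s%:R :> R by rewrite ltr0n ltnW.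
  have hln : ln s%:R <= s%:R / 2 :> R.
    have := @le_ln1Dx R (s%:R / 2 - 1).
    rewrite (_ : 1 + _ = s%:R / 2); last by ring.
    rewrite ln_div ?posrE//.
    have ln2 : ln 2 <= 1 :> R.
      by have := @le_ln1Dx R 1; rewrite -[1 + 1]/(2%:R); apply; lra.
    by have := divr_gt0 s0 (ltr0n R 2); move=> h1 h2; have := h2 _; lra.
  have l0 : 0 <= ln s%:R :> R by rewrite ln_ge0// ler1n ltnW.
  have -> : 2^-1 = s%:R / 2 * s%:R^-1 :> R by field; rewrite gt_eqF.
  apply: ler_pM; rewrite ?expR_ge0// -expRN_ln// ler_expR; nra.
have step s : (3 < s)%N -> t s <= F s.-1%:R - F s%:R.
  move=> s3.
  have sE : s%:R = s.-1%:R + 1 :> R by rewrite natr1 prednK// (leq_trans _ s3).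
  have s3R : 3 <= s.-1%:R :> R.
    by rewrite ler_nat; case: s s3 {sE}.
  have FE : F = (expR \o (- a *: @ln R)) * ((a^-1 *: @ln R) + cst (a ^+ 2)^-1).
    by apply/funext => x; rewrite /F !fctE /GRing.scale/= mulNr [ln x / a]mulrC.
  have [|||x] := @MVT R F (fun x => - (ln x * expR (- ((1 + a) * ln x)))) s.-1%:R s%:R.
  - by rewrite sE ltrDl.
  - move=> x; rewrite in_itv/= => /andP[x3 _].
    have x0 : 0 < x by lra.
    rewrite FE; apply: (is_derive_eq (dF x x0)); rewrite addr0 /GRing.scale/=.
    rewrite !fctE /GRing.scale/=.
    have -> : - ((1 + a) * ln x) = - ln x + - a * ln x by ring.
    rewrite expRD expRN_ln//.
    have alg (E l : R) : E * (a^-1 * x^-1) + (a^-1 * l + (a ^+ 2)^-1) * (E * (- a * x^-1))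
        = - (l * (x^-1 * E)) by field; lra.
    exact: alg.
  - apply: derivable_within_continuous => x; rewrite in_itv/= => /andP[x3 _].
    have x0 : 0 < x by lra.
    by rewrite FE; exact: (@ex_derive _ _ _ _ _ _ _ (dF x x0)).
  rewrite in_itv/= => /andP[sx xs] dFE.
  have -> : F s.-1%:R - F s%:R = ln x * expR (- ((1 + a) * ln x)).
    by rewrite -opprB dFE sE; ring.
  apply: nonincreasing_mul_expRN; first lra.
    rewrite -[1](@expRK R) ler_ln ?posrE ?expR_gt0//; last lra.
    by have := expR1_le3; lra.
  by rewrite ler_ln ?posrE ?ltW//; lra.
have tail k : \sum_(4 <= s < k.+4) t s <= F 3%:R - F k.+3%:R.
  elim: k => [|k IH]; first by rewrite big_geq// subrr.
  by rewrite big_nat_recr//=; have := step k.+4 isT; rewrite /=; lra.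
have F3 : F 3%:R <= (a ^+ 2)^-1.
  rewrite /F -[leRHS]mul1r.
  have -> : ln 3%:R / a + (a ^+ 2)^-1 = (1 + a * ln 3%:R) * (a ^+ 2)^-1 :> R.
    by field; rewrite gt_eqF.
  rewrite mulrA ler_wpM2r ?invr_ge0 ?sqr_ge0// mulrC expRN.
  by rewrite ler_pdivrMr ?expR_gt0// mul1r expR_ge1Dx.
have mono : \sum_(2 <= s < n) t s <= \sum_(2 <= s < n.+4) t s.
  have [n2|n2] := leqP n 2; first by rewrite big_geq// sumr_ge0.
  rewrite [leRHS](@big_cat_nat _ _ _ n)//= ?lerDl ?sumr_ge0//; lia.
apply: le_trans mono _.
rewrite big_ltn// big_ltn//.
by have := tail n; have := small 2%N isT; have := small 3%N isT;
  have := F_ge0 n.+3 isT; lra.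
Qed.
End Series.

(** * Selections of a suboptimal arm *)

Section Regret.
Context (R : realType) (d : measure_display) (Omega : measurableType d)
  (P : probability Omega R) (M N : nat) (hM : (0 < M)%N)
  (e : rel 'I_M) (he : connected_graph e)
  (kappa : R) (hkappa : 0 < kappa <= 1)
  (lambda : 'I_M -> R) (u : 'I_M -> 'cV[R]_M)
  (hspec : spectrum_of (consensus_mx e kappa) lambda u)
  (sigma gamma eta : R)
  (hsigma : 0 < sigma) (hgamma : 1 < gamma) (heta : 0 < eta < 4)
  (f : R -> R) (m : 'I_N -> R)
  (r : 'I_N -> 'I_M -> nat -> {RV P >-> R})
  (act : 'I_M -> nat -> Omega -> 'I_N)
  (hr : reward_model r act m sigma)
  (halg : coop_UCB2 (consensus_mx e kappa) r act sigma gamma eta f).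

Let Pm := consensus_mx e kappa.
Let M0 : 0 < M%:R :> R. Proof. by rewrite ltr0n. Qed.
Let Pm_ge0 n k q : 0 <= (Pm ^+ n) k q.
Proof. by apply: expmx_ge0; apply: consensus_mx_ge0 hkappa; case: he. Qed.
Let Pm_row n k : \sum_q (Pm ^+ n) k q = 1.
Proof. exact: (expmx_row_sum hM hspec). Qed.

Local Notation nh := (nhat (consensus_mx e kappa) act).
Local Notation sh := (shat (consensus_mx e kappa) r act).
Local Notation sel := (selected R act).

(** [sigma ^+ 2] times this bounds the predictable quadratic variation of the
    martingale whose value after round [t] is [shat - m nhat]. *)
Definition variance_proxy j k t w : R :=
  \sum_(1 <= s < t.+1) \sum_q (Pm ^+ (t.+1 - s)) k q ^+ 2 * sel j q s w.

Lemma selected01 j q s w : 0 <= sel j q s w <= 1.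
Proof. by rewrite /selected; case: (_ == _); rewrite ?lexx ?ler01. Qed.

Lemma nhatE j k t w : nh j k t w =
  \sum_(1 <= s < t.+1) \sum_q (Pm ^+ (t.+1 - s)) k q * sel j q s w.
Proof.
rewrite /nhat coop_estE; apply: eq_bigr => s _; apply: eq_bigr => q _.
by rewrite mxE.
Qed.

(** The weight of a reward in the estimate depends on the time [t] of the
    estimate; for each fixed [t] the supermartingale runs over the rounds [s]. *)
Definition tilted_weight (beta : R) k t (s : nat) (q : 'I_M) : R :=
  beta * (Pm ^+ (t.+1 - s)) k q.

Lemma log_supermartingale_est j k t beta w :
  log_supermartingale r act m sigma j (tilted_weight beta k t) t w =
  beta * (sh j k t w - m j * nh j k t w) -
  (sigma * beta) ^+ 2 / 2 * variance_proxy j k t w.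
Proof.
rewrite nhatE /shat coop_estE mulrBr !mulr_sumr -!sumrB.
apply: eq_bigr => s _; rewrite !mulr_sumr -!sumrB.
by apply: eq_bigr => q _; rewrite mxE /gain /tilted_weight /selected; ring.
Qed.

Lemma nhat_le j k t w : nh j k t w <= t%:R.
Proof.
rewrite nhatE.
apply: (@le_trans _ _ (\sum_(1 <= s < t.+1) 1)); last first.
  by rewrite sumr_const_nat subn1.
apply: ler_sum => s _; rewrite -(Pm_row (t.+1 - s) k); apply: ler_sum => q _.
by have /andP[_ h] := selected01 j q s w; rewrite ler_piMr.
Qed.

(** In round [j.+1] all agents select arm [j], and each row of a power of the
    consensus matrix sums to 1. *)
Lemma nhat_ge1 j k t w : (N <= t)%N -> 1 <= nh j k t w.
Proof.
move=> Nt; rewrite nhatE.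
have jt : (j.+1 <= t)%N by apply: leq_trans Nt.
rewrite (@big_cat_nat _ _ _ j.+1)//=; last by rewrite ltnW// ltnS.
rewrite (@big_ltn _ _ _ j.+1)//= addrCA.
rewrite (eq_bigr (fun q => (Pm ^+ (t.+1 - j.+1)) k q)); last first.
  move=> q _; rewrite /selected; have := halg.2 q j.+1 w isT; rewrite ltn_ord => -[/val_inj ->].
  by rewrite eqxx mulr1.
rewrite Pm_row lerDl addr_ge0// sumr_ge0// => s _; rewrite sumr_ge0// => q _;
  by rewrite mulr_ge0//; have /andP[] := selected01 j q s w.
Qed.

Definition selections j t w : R := \sum_(1 <= s < t.+1) \sum_q sel j q s w.

Lemma selections_le_nhat j k t w : selections j t w / M%:R - eps_n lambda <= nh j k t w.
Proof.
have := consensus_count_deviation hM hspec (fun s q => selected01 j q s w) t k.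
by rewrite -nhatE ler_norml -/(selections j t w) => /andP[]; lra.
Qed.

Lemma variance_proxy_le j k t w :
  variance_proxy j k t w <= (nh j k t w + eps_c lambda u k) / M%:R.
Proof.
rewrite ler_pdivlMr// mulrC nhatE.
exact: (consensus_variance_le hM hspec (fun s q => selected01 j q s w) t k).
Qed.

(** The layers start at [(1 + f s) / M], the least value of [(nhat + f s) / M]. *)
Definition tilt_at (s l : nat) : R :=
  tilt sigma gamma eta ((1 + f s%:R) / M%:R) s l.

Definition weight j k s (beta : R) w : R :=
  expR (log_supermartingale r act m sigma j (tilted_weight beta k s) s w).

(** [x] is 1 for an estimate that is too large and -1 for one that is too
    small. *)
Lemma deviation_layer j k s w (x : R) :
  (N <= s)%N -> (0 < s)%N -> eps_c lambda u k <= f s%:R ->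
  x * x = 1 ->
  deviation sigma gamma eta s * Num.sqrt ((nh j k s w + f s%:R) / M%:R) <=
    x * (sh j k s w - m j * nh j k s w) ->
  1 <= expR (- (gamma * ln s%:R)) *
       \sum_(l < layers eta s) weight j k s (x * tilt_at s l) w.
Proof.
move=> Ns s0 fs x2 dev.
have f0 : 0 <= f s%:R by apply: le_trans fs; exact: (eps_c_ge0 hspec).
have n1 := nhat_ge1 j k w Ns; have nle := nhat_le j k s w.
have s1 : 1 <= s%:R :> R by rewrite ler1n.
have g0 : 0 < gamma by move: hgamma; lra.
have c0 : 0 < (1 + f s%:R) / M%:R by rewrite divr_gt0//; lra.
have range : (1 + f s%:R) / M%:R <= (nh j k s w + f s%:R) / M%:R <=
    (1 + f s%:R) / M%:R * s%:R.
  by rewrite mulrAC !ler_pM2r ?invr_gt0//; apply/andP; split; nra.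
have proxy : variance_proxy j k s w <= (nh j k s w + f s%:R) / M%:R.
  apply: le_trans (variance_proxy_le _ _ _ _) _.
  by rewrite ler_pM2r ?invr_gt0// lerD2l.
have [l ll] := peeling hsigma g0 heta c0 s0 range proxy dev.
move=> /= hl.
rewrite (bigD1 (Ordinal ll))//= mulrDr -[leLHS]addr0 lerD//; last first.
  by rewrite mulr_ge0 ?expR_ge0// sumr_ge0// => l' _; exact: expR_ge0.
rewrite /weight -expRD log_supermartingale_est -[leLHS]expR0 ler_expR.
have -> : (sigma * (x * tilt_at s l)) ^+ 2 = (sigma * tilt_at s l) ^+ 2.
  have -> : (sigma * (x * tilt_at s l)) ^+ 2 = (x * x) * (sigma * tilt_at s l) ^+ 2 by ring.
  by rewrite x2 mul1r.
move: hl; rewrite -/(tilt_at s l); lra.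
Qed.

Lemma bonus_nhat j k s w : 0 < nh j k s w ->
  nh j k s w * bonus Pm act sigma gamma eta f j k s w =
  sigma * Num.sqrt (2 * gamma / G eta * ((nh j k s w + f s%:R) / M%:R) * ln s%:R).
Proof.
move=> n0; rewrite /bonus mulrCA; congr (_ * _).
rewrite -{1}[nh j k s w]ger0_norm ?(ltW n0)// -sqrtr_sqr -sqrtrM ?sqr_ge0//.
by congr Num.sqrt; field; rewrite !gt_eqF ?G_gt0.
Qed.

Lemma bonus_deviation j k s w : 0 < nh j k s w -> (0 < s)%N ->
  nh j k s w * bonus Pm act sigma gamma eta f j k s w =
  deviation sigma gamma eta s * Num.sqrt ((nh j k s w + f s%:R) / M%:R).
Proof.
move=> n0 s0; rewrite bonus_nhat// /deviation -[RHS]mulrA -sqrtrM; last first.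
  have lns : 0 <= ln s%:R :> R by rewrite ln_ge0// ler1n.
  by rewrite divr_ge0 ?(ltW (G_gt0 heta))// !mulr_ge0//; move: hgamma; lra.
by congr (_ * Num.sqrt _); ring.
Qed.

Context (istar i : 'I_N) (hi : m i < m istar).

Definition tail_bound k s w : R := expR (- (gamma * ln s%:R)) *
  (\sum_(l < layers eta s) weight i k s (tilt_at s l) w +
   \sum_(l < layers eta s) weight istar k s (- tilt_at s l) w).

Lemma tail_bound_ge0 k s w : 0 <= tail_bound k s w.
Proof.
by rewrite mulr_ge0 ?expR_ge0// addr_ge0// sumr_ge0// => l _; exact: expR_ge0.
Qed.

(** If neither estimate is off by its bonus, the selection of [i] forces the gap
    below twice the bonus of [i]; then [nhat], hence the number of selections, is
    below the assumed value. *)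
Lemma selected_tail k s T w :
  (N <= s)%N -> (1 < s)%N -> (s <= T)%N -> eps_c lambda u k <= f s%:R ->
  f s%:R <= f T%:R -> act k s.+1 w = i ->
  main_term M sigma gamma eta f (m istar - m i) T + M%:R * eps_n lambda <=
    selections i s w ->
  1 <= tail_bound k s w.
Proof.
move=> Ns s1 sT fs fT acti cnt.
have s0 : (0 < s)%N by apply: leq_trans s1.
have f0 : 0 <= f s%:R by apply: le_trans fs; exact: (eps_c_ge0 hspec).
have ni := nhat_ge1 i k w Ns; have nstar := nhat_ge1 istar k w Ns.
have ni0 : 0 < nh i k s w by lra.
have ns0 : 0 < nh istar k s w by lra.
have bi := bonus_deviation ni0 s0; have bs := bonus_deviation ns0 s0.
have e0 := expR_ge0 (- (gamma * ln s%:R)).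
have W0 j x : 0 <= \sum_(l < layers eta s) weight j k s (x * tilt_at s l) w.
  by rewrite sumr_ge0// => l _; exact: expR_ge0.
have [hdev|hdev] := leP (nh i k s w * bonus Pm act sigma gamma eta f i k s w)
   (sh i k s w - m i * nh i k s w).
  rewrite bi -[leRHS]mul1r in hdev.
  have := deviation_layer Ns s0 fs (mulr1 1) hdev.
  rewrite /tail_bound mulrDr; have := W0 istar (-1).
  under eq_bigr do rewrite mulN1r; move=> /(mulr_ge0 e0) h.
  under eq_bigr do rewrite mul1r; lra.
have [hdev'|hdev'] := leP (nh istar k s w * bonus Pm act sigma gamma eta f istar k s w)
   (-1 * (sh istar k s w - m istar * nh istar k s w)).
  rewrite bs in hdev'.
  have xx : -1 * -1 = 1 :> R by ring.
  have := deviation_layer Ns s0 fs xx hdev'.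
  rewrite /tail_bound mulrDr; have := W0 i 1.
  under eq_bigr do rewrite mul1r; move=> /(mulr_ge0 e0) h.
  under eq_bigr do rewrite mulN1r; lra.
exfalso.
have := halg.2 k s.+1 w isT; rewrite ltnNge Ns/= acti => /(_ istar).
rewrite /Qidx /muhat.
set Bi := bonus _ _ _ _ _ _ i _ _ _ in hdev *.
set Bs := bonus _ _ _ _ _ _ istar _ _ _ in hdev' *.
move=> hQ.
have gap : m istar - m i < 2 * Bi.
  have hs : m istar < sh istar k s w / nh istar k s w + Bs.
    rewrite -ltrBlDr ltr_pdivlMr//; move: hdev'; rewrite -/Pm; lra.
  have hii : sh i k s w / nh i k s w + Bi < m i + 2 * Bi.
    by rewrite -ltrBrDr ltr_pdivrMr//; lra.
  by move: hQ hs hii; rewrite -/Pm; lra.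
have widths : (m istar - m i) * nh i k s w < 2 * (sigma * Num.sqrt
    (2 * gamma / G eta * ((nh i k s w + f s%:R) / M%:R) * ln s%:R)).
  by rewrite -bonus_nhat// -/Bi; have := ltr_pM2r ni0 (m istar - m i) (2 * Bi); rewrite gap; lra.
have := selections_le_nhat i k s w.
have lnT : ln s%:R <= ln T%:R :> R by rewrite ler_ln ?posrE ?ltr0n ?ler_nat// (leq_trans s0).
have lns : 0 < ln s%:R :> R by rewrite ln_gt0// ltr1n.
have g0 : 0 < gamma by move: hgamma; lra.
have D0 : 0 < m istar - m i by rewrite subr_gt0.
have phis : 0 <= f s%:R <= f T%:R by rewrite f0.
have lnsT : 0 <= (ln s%:R : R) <= ln T%:R by rewrite (ltW lns).
have := confidence_width_quadratic hsigma g0 (G_gt0 heta) hM D0 (ltW ni0) phis lnsT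
  (lt_le_trans lns lnT) widths.
rewrite -/(main_term M sigma gamma eta f (m istar - m i) T) => q.
rewrite lerBlDr ler_pdivrMr//; lra.
Qed.
Lemma selections_init j t w : (t <= N)%N -> selections j t w = M%:R * (j < t)%N%:R.
Proof.
elim: t => [|t IH] tN; first by rewrite /selections big_geq// mulr0.
rewrite /selections big_nat_recr//= -/(selections j t w) IH ?(ltnW tN)//.
rewrite (eq_bigr (fun=> (j == t :> nat)%:R)) => [|q _]; last first.
  rewrite /selected; congr ((nat_of_bool _)%:R).
  by have := halg.2 q t.+1 w isT; rewrite tN -val_eqE/= => -[->]; rewrite eq_sym.
rewrite sumr_const card_ord -[X in _ + X]mulr_natl -mulrDr -natrD; congr (_ * _%:R).
by rewrite [in RHS]ltnS [in RHS]leq_eqVlt; case: (ltngtP j t).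
Qed.

(** The term [M] is one round of selections: as long as the number of selections
    is below the threshold it can exceed it by at most [M] in the next round, and
    it is at most [M] after the initial phase.  Above the threshold, each further
    selection is charged to [tk] or to [tail_bound]. *)
Lemma selections_le (tk : 'I_M -> R) (T t : nat) w : (1 < N)%N -> (t <= T)%N ->
  0 <= main_term M sigma gamma eta f (m istar - m i) T + M%:R * eps_n lambda ->
  (forall k s, (N <= s)%N -> tk k <= s%:R -> eps_c lambda u k <= f s%:R) ->
  (forall s, (N <= s <= T)%N -> f s%:R <= f T%:R) ->
  selections i t w <=
    main_term M sigma gamma eta f (m istar - m i) T + M%:R * eps_n lambda + M%:R +
    \sum_k \sum_(N <= s < t) ((s%:R < tk k)%R%:R + tail_bound k s w).
Proof.
move=> N1 + A0 epsf fT; set A := main_term _ _ _ _ _ _ _ + _ in A0 *.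
have term0 k s : 0 <= (s%:R < tk k)%R%:R + tail_bound k s w.
  by rewrite addr_ge0 ?ler0n ?tail_bound_ge0.
elim: t => [|t IH] tT.
  rewrite /selections big_geq// addr_ge0//; first by rewrite (addr_ge0 A0)// ler0n.
  by rewrite sumr_ge0// => k _; rewrite sumr_ge0.
have cntS : selections i t.+1 w = selections i t w + \sum_q sel i q t.+1 w.
  by rewrite /selections big_nat_recr.
have sum_sel_le : \sum_q sel i q t.+1 w <= M%:R.
  apply: (@le_trans _ _ (\sum_(q < M) 1)); last by rewrite sumr_const card_ord.
  by apply: ler_sum => q _; have /andP[] := selected01 i q t.+1 w.
have [tN|Nt] := ltnP t N.
  rewrite selections_init//; apply: (@le_trans _ _ M%:R).
    by rewrite ler_piMr// lern1 leq_b1.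
  rewrite -[leLHS]add0r -addrA lerD// lerDl sumr_ge0// => k _.
  by rewrite sumr_ge0.
have [cA|cA] := ltP (selections i t w) A.
  rewrite cntS -[leLHS]addr0 lerD//; first by rewrite lerD// ltW.
  by rewrite sumr_ge0// => k _; rewrite sumr_ge0.
under eq_bigr do rewrite big_nat_recr//=.
rewrite big_split/= addrA cntS lerD ?IH ?(ltnW tT)//.
apply: ler_sum => q _; rewrite /selected; case: eqP => [acti|_]; last exact: term0.
have [ttk|tkt] := ltP t%:R (tk q); first by rewrite lerDl tail_bound_ge0.
rewrite add0r; apply: (@selected_tail q t T) => //.
- exact: leq_trans N1 Nt.
- exact: ltnW.
- exact: epsf.
- by apply: fT; rewrite Nt ltnW.
Qed.

Lemma measurable_weight j k s beta :
  measurable_fun [set: Omega] (weight j k s beta).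
Proof.
apply: measurableT_comp; first exact: measurable_expR.
by apply: measurable_log_supermartingale => k' t i'; exact: halg.1.
Qed.

Lemma measurable_tail_bound k s : measurable_fun [set: Omega] (tail_bound k s).
Proof.
apply: measurable_funM => //; apply: measurable_funD; apply: measurable_sum => l;
  exact: measurable_weight.
Qed.

Lemma integral_tail_bound_le k s :
  (\int[P]_w (tail_bound k s w)%:E <=
    (expR (- (gamma * ln s%:R)) * (2 * (layers eta s)%:R))%:E)%E.
Proof.
have w0 j beta w : (0 <= (weight j k s beta w)%:E)%E by rewrite lee_fin expR_ge0.
have mw j beta : measurable_fun [set: Omega] (fun w => (weight j k s beta w)%:E).
  by apply/measurable_EFinP; exact: measurable_weight.
have sum_le j (b : nat -> R) :
    (\sum_(l < layers eta s) \int[P]_w (weight j k s (b l) w)%:E <=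
     (layers eta s)%:R%:E)%E.
  apply: (@le_trans _ _ (\sum_(l < layers eta s) 1%:E)%E); last first.
    by rewrite sumEFin sumr_const card_ord.
  apply: lee_sum => l _; apply: integral_log_supermartingale_le1 => //.
  by move=> k' t i'; exact: halg.1.
under eq_integral do rewrite /tail_bound EFinM EFinD -!sumEFin.
rewrite ge0_integralZl//; last 2 first.
- by apply: emeasurable_funD; apply: emeasurable_sum.
- by move=> w _; rewrite adde_ge0// sume_ge0.
rewrite EFinM lee_wpmul2l ?lee_fin ?expR_ge0//.
rewrite ge0_integralD//; last 4 first.
- by move=> w _; rewrite sume_ge0.
- exact: emeasurable_sum.
- by move=> w _; rewrite sume_ge0.
- exact: emeasurable_sum.
rewrite !ge0_integral_sum// mulrDl mul1r EFinD leeD//.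
exact: (sum_le istar (fun l => - tilt_at s l)).
Qed.

Lemma sum_nsel w T : \sum_(k < M) (nsel act i k T w)%:R = selections i T w :> R.
Proof.
rewrite /selections exchange_big/=; apply: eq_bigr => k _.
by rewrite /nsel natr_sum.
Qed.

Lemma expected_selections_le (tk : 'I_M -> R) (T : nat) : (1 < N)%N ->
  0 <= main_term M sigma gamma eta f (m istar - m i) T + M%:R * eps_n lambda ->
  (forall k s, (N <= s)%N -> tk k <= s%:R -> eps_c lambda u k <= f s%:R) ->
  (forall s, (N <= s <= T)%N -> f s%:R <= f T%:R) ->
  (\sum_(k < M) 'E_P[fun w => (nsel act i k T w)%:R] <=
   (main_term M sigma gamma eta f (m istar - m i) T + M%:R * eps_n lambda + M%:R +
    \sum_k \sum_(N <= s < T) ((s%:R < tk k)%R%:R +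
      expR (- (gamma * ln s%:R)) * (2 * (layers eta s)%:R)))%:E)%E.
Proof.
move=> N1 A0 epsf fT; set A := main_term _ _ _ _ _ _ _ + _ in A0 *.
have mnsel k : measurable_fun [set: Omega] (fun w => (nsel act i k T w)%:R : R).
  rewrite (_ : (fun w => _) = fun w => \sum_(1 <= s < T.+1) sel i k s w); last first.
    by apply/funext => w; rewrite /nsel natr_sum.
  under eq_fun do rewrite big_seq big_mkcond/=.
  apply: measurable_sum => s; rewrite mem_index_iota.
  case: (boolP (0 < s < T.+1)%N) => // /andP[s0 _].
  by apply: measurable_selected => // k' t i'; exact: halg.1.
have mtail k s : measurable_fun [set: Omega] (fun w => (tail_bound k s w)%:E).
  by apply/measurable_EFinP; exact: measurable_tail_bound.
have tail0 k s w : (0 <= (tail_bound k s w)%:E)%E by rewrite lee_fin tail_bound_ge0.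
pose C := A + M%:R + \sum_k \sum_(N <= s < T) (s%:R < tk k)%R%:R.
have C0 : 0 <= C.
  rewrite addr_ge0//; first by rewrite (addr_ge0 A0)// ler0n.
  by rewrite sumr_ge0// => k _; rewrite sumr_ge0// => s _; exact: ler0n.
under eq_bigr do rewrite unlock.
rewrite -ge0_integral_sum//; last first.
- by move=> k; exact/measurable_EFinP.
have msums : measurable_fun [set: Omega]
    (fun w => \sum_k \sum_(N <= s < T) (tail_bound k s w)%:E)%E.
  by apply: emeasurable_sum => k; apply: emeasurable_sum.
apply: (@le_trans _ _ (\int[P]_w
    (C%:E + \sum_k \sum_(N <= s < T) (tail_bound k s w)%:E))%E).
  apply: ge0_le_integral => //.
  - by move=> w _; rewrite sume_ge0// => k _; rewrite lee_fin ler0n.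
  - by apply: emeasurable_sum => k; exact/measurable_EFinP.
  - exact: emeasurable_funD.
  - move=> w _; rewrite sumEFin sum_nsel.
    under eq_bigr do rewrite sumEFin.
    rewrite sumEFin -EFinD lee_fin.
    apply: le_trans (selections_le w N1 (leqnn T) A0 epsf fT) _.
    under eq_bigr do rewrite big_split/=.
    by rewrite big_split/= addrA.
rewrite ge0_integralD//; last first.
- by move=> w _; rewrite sume_ge0// => k _; rewrite sume_ge0.
have -> : (\int[P]_(_ in setT) C%:E = C%:E)%E.
  by rewrite integral_cst//; apply: etrans (congr1 _ (probability_setT P)) (mule1 _).
rewrite ge0_integral_sum//; last 2 first.
- by move=> k; exact: emeasurable_sum.
- by move=> k w _; rewrite sume_ge0.
rewrite [leRHS](_ : _ = (C%:E + \sum_(k < M) \sum_(N <= s < T)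
   (expR (- (gamma * ln s%:R)) * (2 * (layers eta s)%:R))%:E)%E); last first.
  under [in RHS]eq_bigr do rewrite sumEFin.
  rewrite sumEFin -EFinD; congr _%:E.
  under eq_bigr do rewrite big_split/=.
  by rewrite big_split/= addrA.
rewrite leeD2l//; apply: lee_sum => k _.
rewrite ge0_integral_sum//; apply: lee_sum => s _; exact: integral_tail_bound_le.
Qed.

End Regret.

Lemma sum_before_le (R : realType) (x : R) N T : (0 < N)%N -> 0 <= x ->
  \sum_(N <= s < T) (s%:R < x)%R%:R <= x.
Proof.
move=> N0 x0; elim: T => [|T IH]; first by rewrite big_geq.
have [TN|NT] := ltnP T N; first by rewrite big_geq.
have [Tx|xT] := ltP T%:R x; last first.
  by rewrite big_nat_recr//= ltNge xT addr0.
apply: (@le_trans _ _ (\sum_(N <= s < T.+1) 1)).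
  by apply: ler_sum => s _; rewrite lern1 leq_b1.
by rewrite sumr_const_nat; apply: le_trans (ltW Tx); rewrite ler_nat; lia.
Qed.

Lemma sum_layer_tails_le (R : realType) (gamma eta : R) N T :
  1 < gamma -> 0 < eta -> (1 < N)%N ->
  \sum_(N <= s < T) expR (- (gamma * ln s%:R)) * (2 * (layers eta s)%:R) <=
  2 * ((((gamma - 1) ^+ 2)^-1 + 1) / ln (1 + eta) + (gamma - 1)^-1).
Proof.
move=> g1 e0 N1.
have ell0 : 0 < ln (1 + eta) by rewrite ln_gt0; lra.
have a0 : 0 < gamma - 1 by lra.
pose F s : R := expR (- (gamma * ln s%:R)) * (2 * (layers eta s)%:R).
have F0 s : 0 <= F s by rewrite mulr_ge0 ?expR_ge0// mulr_ge0 ?ler0n.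
apply: (@le_trans _ _ (\sum_(2 <= s < T) F s)).
  have [TN|NT] := leqP T N; first by rewrite big_geq// sumr_ge0.
  by rewrite [leRHS](@big_cat_nat _ _ _ N)//= ?(ltnW NT)// lerDr sumr_ge0.
apply: (@le_trans _ _ (\sum_(2 <= s < T)
   2 * (ln s%:R * expR (- ((1 + (gamma - 1)) * ln s%:R)) / ln (1 + eta) +
        expR (- ((1 + (gamma - 1)) * ln s%:R))))).
  rewrite big_seq [leRHS]big_seq; apply: ler_sum => s.
  rewrite mem_index_iota => /andP[s2 _].
  rewrite (_ : 1 + (gamma - 1) = gamma); last by ring.
  have := layers_le e0 (ltnW s2); rewrite /F.
  have := expR_ge0 (- (gamma * ln s%:R)); set E := expR _ => E0 h.
  have := ler_wpM2l E0 h; lra.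
rewrite -mulr_sumr ler_wpM2l// big_split/= lerD//.
  by rewrite -mulr_suml ler_wpM2r ?invr_ge0 ?(ltW ell0)// sum_ln_expRN_ln_le.
exact: sum_expRN_ln_le.
Qed.

Lemma eps_n_ge0 (R : realType) (M : nat) (Pm : 'M[R]_M) lambda u :
  spectrum_of Pm lambda u -> 0 <= eps_n lambda.
Proof.
move=> spec; rewrite mulr_ge0 ?sqrtr_ge0// sumr_ge0// => p p1.
by rewrite divr_ge0// subr_ge0 ltW// (normr_eigenvalue_lt1 spec).
Qed.

Lemma main_term_ge0 (R : realType) (M : nat) (sigma gamma eta : R) (f : R -> R)
    (Delta : R) (T : nat) :
  0 < gamma -> 0 < eta < 4 -> (0 < T)%N ->
  0 <= main_term M sigma gamma eta f Delta T.
Proof.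
move=> g0 e4 T0; have lnT : 0 <= ln T%:R :> R by rewrite ln_ge0 // ler1n.
rewrite /main_term mulr_ge0 ?addr_ge0 ?sqrtr_ge0//.
have G0 := ltW (G_gt0 e4).
rewrite divr_ge0//; last by rewrite mulr_ge0 ?sqr_ge0.
by rewrite mulr_ge0// mulr_ge0 ?(ltW g0)// mulr_ge0 ?sqr_ge0.
Qed.

Theorem theorem2 (R : realType) (d : measure_display) (Omega : measurableType d)
    (P : probability Omega R) (M N : nat) (hM : (0 < M)%N)
    (e : rel 'I_M) (he : connected_graph e)
    (kappa : R) (hkappa : 0 < kappa <= 1)
    (lambda : 'I_M -> R) (u : 'I_M -> 'cV[R]_M)
    (hspec : spectrum_of (consensus_mx e kappa) lambda u)
    (sigma gamma eta : R)
    (hsigma : 0 < sigma) (hgamma : 1 < gamma) (heta : 0 < eta < 4)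
    (t0 : R) (ht0 : 0 <= t0 <= 1)
    (f finv : R -> R) (hf : increasing_sublog t0 f)
    (hfinv : forall t, t0 <= t -> finv (f t) = t)
    (hrange : forall k : 'I_M, exists2 t, t0 <= t & f t = eps_c lambda u k)
    (m : 'I_N -> R) (hm : injective m)
    (istar : 'I_N) (histar : forall i, m i <= m istar)
    (r : 'I_N -> 'I_M -> nat -> {RV P >-> R})
    (act : 'I_M -> nat -> Omega -> 'I_N)
    (hr : reward_model r act m sigma)
    (halg : coop_UCB2 (consensus_mx e kappa) r act sigma gamma eta f)
    (i : 'I_N) (hi : i != istar) (T : nat) (hT : (0 < T)%N) :
  (\sum_(k < M) 'E_P[fun w => (nsel act i k T w)%:R] <=
   (main_term M sigma gamma eta f (m istar - m i) T +
    Lconst gamma eta finv (eps_n lambda) (eps_c lambda u))%:E)%E.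
Proof.
have gap : m i < m istar.
  by rewrite lt_neqAle histar andbT; apply: contra_neq hi => /hm.
have N1 : (1 < N)%N.
  case: N i istar hi {m hm histar r act hr halg gap} => [[]//|[|//]] i' j'.
  by rewrite (ord1 i') (ord1 j') eqxx.
have [e0 _] := andP heta; have [t00 t01] := andP ht0.
have en0 := eps_n_ge0 hspec.
have A0 : 0 <= main_term M sigma gamma eta f (m istar - m i) T + M%:R * eps_n lambda.
  by apply: addr_ge0; [apply: main_term_ge0 => //; lra|rewrite mulr_ge0 ?ler0n].
have fmono x y : t0 <= x -> x <= y -> f x <= f y.
  by move=> tx; rewrite le_eqVlt => /predU1P[->//|/(hf.1 _ _ tx)/ltW].
pose tk k := finv (eps_c lambda u k).
have tkP k : t0 <= tk k /\ f (tk k) = eps_c lambda u k.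
  by have [t tt ft] := hrange k; rewrite /tk -ft hfinv.
have epsf k s : (N <= s)%N -> tk k <= s%:R -> eps_c lambda u k <= f s%:R.
  by move=> _ ts; have [tt <-] := tkP k; exact: fmono.
have fT s : (N <= s <= T)%N -> f s%:R <= f T%:R.
  move=> /andP[Ns sT]; apply: fmono; last by rewrite ler_nat.
  by apply: (le_trans t01); rewrite ler1n; lia.
apply: le_trans (expected_selections_le hM he hkappa hspec hsigma hgamma heta hr halg
  gap N1 A0 epsf fT) _.
rewrite lee_fin.
set ell := ln (1 + eta).
have ell0 : 0 < ell by rewrite ln_gt0; lra.
pose S := 2 * ((((gamma - 1) ^+ 2)^-1 + 1) / ell + (gamma - 1)^-1).
have sums : \sum_k \sum_(N <= s < T) ((s%:R < tk k)%R%:R +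
      expR (- (gamma * ln s%:R)) * (2 * (layers eta s)%:R)) <=
    \sum_k tk k + M%:R * S.
  rewrite (_ : M%:R * S = \sum_(k < M) S); last first.
    by rewrite sumr_const card_ord mulr_natl.
  rewrite -big_split/=; apply: ler_sum => k _; rewrite big_split/= lerD//.
    apply: sum_before_le; first exact: ltnW.
    exact: le_trans (tkP k).1.
  exact: sum_layer_tails_le.
apply: le_trans (lerD (lexx _) sums) _.
rewrite /Lconst -/ell -/tk sumrB sumr_const card_ord.
have lnle : ell <= ln ((1 + eps_n lambda) * (1 + eta)).
  by rewrite ler_ln ?posrE; nra.
set q := ln _ in lnle *.
have a0 : 0 < gamma - 1 by lra.
(* the terms of [Lconst] with [eps_n] dominate their values at [eps_n = 0] *)
have bnd : 1 + (gamma - 1)^-1 <= gamma * q / (gamma - 1) / ell.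
  have -> : gamma * q / (gamma - 1) / ell = (1 + (gamma - 1)^-1) * (q / ell).
    by field; lra.
  by rewrite ler_peMr ?ler_pdivlMr ?mul1r// addr_ge0// invr_ge0 ltW.
have M0 : 0 <= M%:R :> R by rewrite ler0n.
rewrite (_ : 2 * M%:R / ell * _ = M%:R * (2 * ((((gamma - 1) ^+ 2)^-1 + 1) / ell +
   gamma * q / (gamma - 1) / ell))); last by field; lra.
have := ler_wpM2l M0 bnd; rewrite /S; lra.
Qed.
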